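(* Let $(X,\mu)$ and $(Y,\nu)$ be standard measure spaces, at least one of which is non-atomic, let $H$ be a separable Hilbert space and $A\subseteq\mathcal{O}(H)$ a separable $C^*$-algebra. If $\varphi:X\times Y\to CB(A,\mathcal{O}(H))$ is a compact Schur $A$-multiplier, then $\varphi(x,y)=0$ for $(\mu\times\nu)$-almost all $(x,y)\in X\times Y$.
   Context: $\mathcal{O}(H)$ denotes the bounded operators on $H$ and $CB(A,\mathcal{O}(H))$ the completely bounded linear maps $A\to\mathcal{O}(H)$. A standard measure space is a measure space $(X,\mu)$ for which there is a locally compact, metrisable, complete, separable topology on $X$ (an admissible topology) with respect to which $\mu$ is a regular Borel $\sigma$-finite measure. $\mathfrak{L}_2(Z,B)$ denotes the square integrable measurable functions from a measure space $Z$ into a Banach space $B$; $\mathfrak{L}_2(Z)=\mathfrak{L}_2(Z,\mathbb{C})$. For a kernel $k\in\mathfrak{L}_2(Y\times X,\mathcal{O}(H))$ (also for weakly measurable square integrable $k$), $T_k:\mathfrak{L}_2(X,H)\to\mathfrak{L}_2(Y,H)$ is the bounded operator $(T_k\xi)(y)=\int_Xk(y,x)\xi(x)\,d\mu(x)$. Put $\mathcal{S}_2(Y\times X,A)=\{T_k:k\in\mathfrak{L}_2(Y\times X,A)\}$; this is a dense subspace of the minimal tensor product $\mathcal{O}_c\otimes A$, where $\mathcal{O}_c$ is the space of compact operators from $\mathfrak{L}_2(X)$ to $\mathfrak{L}_2(Y)$, and it carries the operator space structure inherited from operators $\mathfrak{L}_2(X,H)\to\mathfrak{L}_2(Y,H)$.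 A function $\varphi:X\times Y\to CB(A,\mathcal{O}(H))$ is pointwise measurable if for every $a\in A$ the function $(x,y)\mapsto\varphi(x,y)(a)\in\mathcal{O}(H)$ is weakly measurable. For a bounded pointwise measurable $\varphi$ and $k\in\mathfrak{L}_2(Y\times X,A)$ put $(\varphi\cdot k)(y,x)=\varphi(x,y)(k(y,x))$ and $S_\varphi(T_k)=T_{\varphi\cdot k}$. $\varphi$ is a Schur $A$-multiplier if the linear map $S_\varphi$ defined on $\mathcal{S}_2(Y\times X,A)$ is completely bounded; then $S_\varphi$ extends to a completely bounded map on $\mathcal{O}_c\otimes A$, still denoted $S_\varphi$. $\varphi$ is a compact Schur $A$-multiplier if $S_\varphi$ is moreover a compact operator. *)

(* Defs.v *)
From mathcomp Require Import all_boot all_order all_algebra.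
From mathcomp Require Export sesquilinear complex.
From mathcomp Require Import all_classical all_reals all_analysis.

Set Implicit Arguments.
Unset Strict Implicit.
Unset Printing Implicit Defensive.

Import Order.TTheory GRing.Theory Num.Theory.
Import numFieldNormedType.Exports.

Local Open Scope classical_set_scope.
Local Open Scope ring_scope.

(* A normed space presented by representatives: the submodule [dom] of the
   module [carrier], on which [nrm] is a seminorm, stands for the normed space
   dom / {v | nrm v = 0}.  Functions equal almost everywhere are thus handled
   without forming quotients.  [nrm] is meaningless outside [dom]. *)
Record seminormed (R : realType) := Seminormed {
  carrier :> lmodType R[i] ;
  dom : set carrier ;
  nrm : carrier -> R }.

Arguments dom {R} s _.
Arguments nrm {R} s _.

Section seminormed_spaces.
Variable R : realType.
Implicit Types V W : seminormed R.

Definition subspace V (S : set V) : seminormed R :=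
  @Seminormed R V (dom V `&` S) (nrm V).

(* V^n with the Hilbert (l2) sum norm *)
Definition power n V : seminormed R :=
  @Seminormed R ('I_n -> V : lmodType R[i])
    [set v | forall i, dom V (v i)]
    (fun v => Num.sqrt (\sum_i nrm V (v i) ^+ 2)).

(* Linearity is modulo vectors of norm zero; the last clause makes T compatible
   with that identification. *)
Definition bounded_op V W (T : V -> W) : Prop :=
  [/\ forall v, dom V v -> dom W (T v),
      forall (a : R[i]) u v, dom V u -> dom V v ->
        nrm W (T (a *: u + v) - (a *: T u + T v)) = 0
    & exists c : R, forall v, dom V v -> nrm W (T v) <= c * nrm V v].

Definition opnorm V W (T : V -> W) : R :=
  sup [set nrm W (T v) | v in [set v | dom V v /\ nrm V v <= 1]].

Definition bounded_ops V W : seminormed R :=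
  @Seminormed R (V -> W : lmodType R[i]) (@bounded_op V W) (@opnorm V W).

Definition norm_open V (U : set V) : Prop :=
  forall u, dom V u -> U u ->
    exists2 e : R, 0 < e & forall v, dom V v -> nrm V (v - u) < e -> U v.

Definition norm_closure V (S : set V) : set V :=
  [set v | dom V v /\
    forall e : R, 0 < e -> exists2 s, S s & nrm V (v - s) < e].

Definition norm_separable V (S : set V) : Prop :=
  exists D : set V,
    [/\ countable D, D `<=` S & S `<=` norm_closure D].

Definition compact_op V W (T : V -> W) : Prop :=
  bounded_op T /\
  forall v : nat -> V, (forall n, dom V (v n) /\ nrm V (v n) <= 1) ->
    exists s : nat -> nat, {homo s : m n / (m < n)%N} /\
      exists2 w, dom W w & nrm W (T (v (s n)) - w) @[n --> \oo] --> (0 : R).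

(* The operator V^n -> W^n with matrix t *)
Definition matrix_op V W n (t : 'I_n -> 'I_n -> V -> W) :
    power n V -> power n W :=
  fun v i => \sum_j t i j (v j).

Definition cb_norm_le V W V' W' (S : set (bounded_ops V W))
    (F : bounded_ops V W -> bounded_ops V' W') (c : R) : Prop :=
  forall n (t : 'I_n -> 'I_n -> V -> W), (forall i j, S (t i j)) ->
    opnorm (matrix_op (fun i j => F (t i j))) <= c * opnorm (matrix_op t).

(* F is a completely bounded map from the operator space S, a linear subspace
   of the bounded operators V -> W, to the bounded operators V' -> W'. *)
Definition completely_bounded V W V' W' (S : set (bounded_ops V W))
    (F : bounded_ops V W -> bounded_ops V' W') : Prop :=
  @bounded_op (subspace S) (bounded_ops V' W') F /\
  exists c : R, cb_norm_le S F c.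

Definition scalars : seminormed R :=
  @Seminormed R (R[i]^o : lmodType R[i]) setT (fun z => complex.Re `|z|).

Definition normed (H : normedModType R[i]) : seminormed R :=
  @Seminormed R H setT (fun h => complex.Re `|h|).

Definition L2 d (Z : measurableType d) (m : {measure set Z -> \bar R}) V : seminormed R :=
  @Seminormed R (Z -> V : lmodType R[i])
    [set f | [/\ forall z, dom V (f z),
                 forall U, norm_open U -> measurable (f @^-1` U)
               & (\int[m]_z (nrm V (f z) ^+ 2)%:E < +oo)%E]]
    (fun f => Num.sqrt (\int[m]_z (nrm V (f z) ^+ 2))).

End seminormed_spaces.

Section measure_spaces.
Variables (R : realType) (d : measure_display) (X : measurableType d).

(* The bijection f transports the topology of T to X. *)
Definition admissible_topology (mu : set X -> \bar R)
    (T : metricType R) (f : X -> T) : Prop :=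
  [/\ bijective f,
      locally_compact [set: T],
      (forall F : set_system T, ProperFilter F -> cauchy F ->
        exists t : T, F --> t),
      (exists2 D : set T, countable D & dense D)
    & [/\ (forall E : set X, measurable E <->
             exists2 B : set T, <<s open >> B & E = f @^-1` B),
          (forall E, measurable E -> mu E =
             ereal_inf [set mu (f @^-1` U) | U in
               [set U : set T | open U /\ E `<=` f @^-1` U]])
        & (forall E, measurable E -> mu E =
             ereal_sup [set mu (f @^-1` K) | K in
               [set K : set T | compact K /\ f @^-1` K `<=` E]])]].

Definition standard_measure (mu : {sigma_finite_measure set X -> \bar R}) :
    Prop :=
  exists (T : metricType R) (f : X -> T), admissible_topology mu f.

Definition nonatomic (mu : set X -> \bar R) : Prop :=
  forall E, measurable E -> (0 < mu E)%E ->
    exists F, [/\ measurable F, F `<=` E, (0 < mu F)%E & (mu F < mu E)%E].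

End measure_spaces.

Section operators_on_Hilbert_space.
Variables (R : realType) (H : completeNormedModType R[i]).
Variable (dot : {dot H for (@Num.conj R[i])}).

(* linear in the first variable, conjugate linear in the second *)
Definition norm_from_dot : Prop := forall x, `|x| ^+ 2 = dot x x.

Definition separable_space : Prop :=
  exists2 D : set H, countable D & dense D.

Definition BH : seminormed R := bounded_ops (normed H) (normed H).

Definition Cstar_subalgebra (A : set BH) : Prop :=
  [/\ A `<=` dom BH,
      [/\ A 0, (forall a b, A a -> A b -> A (a + b))
        & forall (c : R[i]) a, A a -> A (c *: a)],
      (forall a b, A a -> A b -> A (a \o b)),
      (forall a, A a -> exists2 b, A b & forall x y, dot (a x) y = dot x (b y))
    & norm_closure A `<=` A].

Definition integral_C d (Z : measurableType d) (m : {measure set Z -> \bar R})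
    (f : Z -> R[i]) : R[i] :=
  ((\int[m]_z complex.Re (f z)) +i* (\int[m]_z complex.Im (f z)))%C.

Definition integrable_C d (Z : measurableType d) (m : {measure set Z -> \bar R})
    (f : Z -> R[i]) : Prop :=
  m.-integrable setT (fun z => (complex.Re (f z))%:E) /\
  m.-integrable setT (fun z => (complex.Im (f z))%:E).

(* v is the (weak) integral of f *)
Definition is_integral_H d (Z : measurableType d) (m : {measure set Z -> \bar R})
    (f : Z -> H) (v : H) : Prop :=
  forall e, integrable_C m (fun z => dot (f z) e) /\
    dot v e = integral_C m (fun z => dot (f z) e).

Definition weakly_measurable d (Z : measurableType d) (f : Z -> BH) : Prop :=
  forall x y, measurable_fun setT (fun z => complex.Re (dot (f z x) y)) /\
              measurable_fun setT (fun z => complex.Im (dot (f z x) y)).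

Section Schur_multipliers.
Variables (dX dY : measure_display).
Variables (X : measurableType dX) (Y : measurableType dY).
Variable mu : {sigma_finite_measure set X -> \bar R}.
Variable nu : {sigma_finite_measure set Y -> \bar R}.
Variable A : set BH.

Definition L2XH := L2 mu (normed H).
Definition L2YH := L2 nu (normed H).
Definition ops : seminormed R := bounded_ops L2XH L2YH.

Definition L2_kernel (k : Y * X -> BH) : Prop :=
  dom (L2 (nu \x mu)%E (subspace A)) k.

(* T = T_k *)
Definition kernel_op (k : Y * X -> BH) (T : ops) : Prop :=
  dom ops T /\
  forall xi, dom L2XH xi ->
    {ae nu, forall y, is_integral_H mu (fun x => k (y, x) (xi x)) (T xi y)}.

Definition S2 : set ops :=
  [set T | exists2 k, L2_kernel k & kernel_op k T].

(* T = K (x) a under the identification of L2(X,H) with L2(X) (x) H *)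
Definition elementary_tensor
    (K : L2 mu (scalars R) -> L2 nu (scalars R)) (a : BH) (T : ops) : Prop :=
  dom ops T /\
  forall (f : X -> R[i]) (h : H), dom (L2 mu (scalars R)) f ->
    nrm L2YH (T (fun x => f x *: h) - (fun y => K f y *: a h)) = 0.

(* The spatial (minimal) tensor product of the space of compact operators
   L2(X) -> L2(Y) with A *)
Definition compact_tensor : set ops :=
  norm_closure [set T : ops | exists n (t : 'I_n -> ops),
    (forall i, exists K a,
       [/\ compact_op K, A a & elementary_tensor K a (t i)]) /\
    T = \sum_i t i].

Variable phi : X * Y -> BH -> BH.

Definition pointwise_measurable : Prop :=
  forall a, A a -> weakly_measurable (fun z => phi z a).

Definition cb_valued : Prop := forall z, completely_bounded A (phi z).

Definition cb_norm_bounded : Prop :=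
  exists c : R, forall z, cb_norm_le A (phi z) c.

Definition schur_mul (k : Y * X -> BH) : Y * X -> BH :=
  fun z => phi (z.2, z.1) (k z).

(* F sends T_k to T_(phi . k) for k in L2(Y x X, A) *)
Definition agrees_with_S_phi (F : ops -> ops) : Prop :=
  forall k T, L2_kernel k -> kernel_op k T -> kernel_op (schur_mul k) (F T).

Definition Schur_multiplier : Prop :=
  [/\ cb_valued, cb_norm_bounded, pointwise_measurable
    & exists2 F : ops -> ops, agrees_with_S_phi F & completely_bounded S2 F].

(* F is the completely bounded extension of S_phi to compact_tensor, unique up
   to operators of norm zero because S2 is dense there. *)
Definition compact_Schur_multiplier : Prop :=
  Schur_multiplier /\
  exists F : ops -> ops,
    [/\ agrees_with_S_phi F, completely_bounded compact_tensor F
      & @compact_op R (subspace compact_tensor) ops F].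

End Schur_multipliers.
End operators_on_Hilbert_space.

(* Main.v *)
Require Import Defs.
From mathcomp Require Import all_boot all_order all_algebra.
From mathcomp Require Import all_classical all_reals all_analysis.
From mathcomp Require Import ring lra measurable_realfun.
Set Implicit Arguments.
Unset Strict Implicit.
Unset Printing Implicit Defensive.
Import Order.TTheory GRing.Theory Num.Theory numFieldNormedType.Exports.
Local Open Scope classical_set_scope.
Local Open Scope ring_scope.

(** Take [u_n], [v_n] to be the L2-normalised indicators of sets [E_n] and [F_n]
    of finite positive measure such that the rectangles [E_n * F_n] are pairwise
    disjoint.  For [a] in [A] the operators [T_n] with kernel
    [(y, x) |-> v_n(y) u_n(x) a] lie in the tensor product and are bounded by
    [opnorm a].  Pairing [S_phi(T_m)] with [u_n h] and [v_n g] gives [0] when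
    [m <> n], and the average of [b(x, y) = Re <phi(x, y)(a) h, g>] over
    [E_n * F_n] when [m = n].  A norm convergent subsequence of [S_phi(T_n)]
    therefore forces some of these averages to be arbitrarily small.  If, say,
    [mu] is non-atomic and the integral of [b] over [E * F] were not zero, then
    the function [x |-> int_F b(x, y) dnu(y)] or its opposite would be at least
    some [e > 0] on a subset of [E] of positive measure, which splits into
    infinitely many disjoint [E_n] of positive measure: the averages of [b] over
    [E_n * F] would stay away from [0].  So [b] has integral zero over all
    rectangles, hence vanishes almost everywhere, and separability of [A] and
    [H] finishes the proof. *)

(** * Hilbert spaces and the Riesz representation *)

Section complex_facts.
Variable R : realType.
Implicit Types z w : R[i].

Lemma ReD z w : complex.Re (z + w) = complex.Re z + complex.Re w.
Proof. by case: z; case: w. Qed.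

Lemma ImD z w : complex.Im (z + w) = complex.Im z + complex.Im w.
Proof. by case: z; case: w. Qed.

Lemma ReB z w : complex.Re (z - w) = complex.Re z - complex.Re w.
Proof. by case: z; case: w. Qed.

Lemma ImB z w : complex.Im (z - w) = complex.Im z - complex.Im w.
Proof. by case: z; case: w. Qed.

Lemma ReM z w : complex.Re (z * w) =
  complex.Re z * complex.Re w - complex.Im z * complex.Im w.
Proof. by case: z; case: w. Qed.

Lemma ImM z w : complex.Im (z * w) =
  complex.Re z * complex.Im w + complex.Im z * complex.Re w.
Proof. by case: z; case: w. Qed.

Lemma ReZ (r : R) z : complex.Re (r%:C%C * z) = r * complex.Re z.
Proof. by rewrite ReM /= mul0r subr0. Qed.

Lemma ImZ (r : R) z : complex.Im (r%:C%C * z) = r * complex.Im z.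
Proof. by rewrite ImM /= mul0r addr0. Qed.

Lemma eq_complex_ReIm z w : complex.Re z = complex.Re w -> complex.Im z = complex.Im w -> z = w.
Proof. by case: z; case: w => ? ? ? ? /= -> ->. Qed.

Lemma Re_normC_sqrt z : complex.Re `|z| = Num.sqrt (complex.Re z ^+ 2 + complex.Im z ^+ 2).
Proof. by rewrite normc_def. Qed.

Lemma Re_normCK z : (complex.Re `|z|)%:C%C = `|z|.
Proof. by rewrite normc_def. Qed.

Lemma Re_normC_ge0 z : 0 <= complex.Re `|z|.
Proof. by rewrite Re_normC_sqrt sqrtr_ge0. Qed.

Lemma Re_normC_real (r : R) : complex.Re `|r%:C%C| = `|r|.
Proof. by rewrite Re_normC_sqrt /= expr0n /= addr0 sqrtr_sqr. Qed.

Lemma Re_normC_le z : complex.Re `|z| <= `|complex.Re z| + `|complex.Im z|.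
Proof.
rewrite Re_normC_sqrt -[leRHS]ger0_norm ?addr_ge0// -sqrtr_sqr ler_sqrt ?sqr_ge0//.
rewrite sqrrD !real_normK ?num_real// lerD2r lerDl mulrn_wge0//.
Qed.

Lemma normr_Re_le z : `|complex.Re z| <= complex.Re `|z|.
Proof. by rewrite Re_normC_sqrt -sqrtr_sqr ler_sqrt ?addr_ge0 ?sqr_ge0// lerDl sqr_ge0. Qed.

Lemma normr_Im_le z : `|complex.Im z| <= complex.Re `|z|.
Proof. by rewrite Re_normC_sqrt -sqrtr_sqr ler_sqrt ?addr_ge0 ?sqr_ge0// lerDr sqr_ge0. Qed.

Lemma Re_normCM z w : complex.Re `|z * w| = complex.Re `|z| * complex.Re `|w|.
Proof. by rewrite normrM -(Re_normCK z) ReZ. Qed.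

Lemma Re_conjc z : complex.Re z^*%C = complex.Re z.
Proof. by case: z. Qed.

End complex_facts.

Section real_normed.
Variables (R : realType) (H : normedModType R[i]).
Implicit Types x y : H.

Lemma Re_norm_ge0 x : 0 <= complex.Re `|x|.
Proof. by have := normr_ge0 x; rewrite lecE => /andP[]. Qed.

Lemma Im_norm x : complex.Im `|x| = 0.
Proof. by have := normr_ge0 x; rewrite lecE => /andP[/eqP]. Qed.

Lemma Re_normK x : (complex.Re `|x|)%:C%C = `|x|.
Proof. by apply: eq_complex_ReIm; rewrite ?Im_norm. Qed.

Lemma Re_normD x y : complex.Re `|x + y| <= complex.Re `|x| + complex.Re `|y|.
Proof. by rewrite -ReD; have := ler_normD x y; rewrite lecE => /andP[]. Qed.

Lemma Re_normZ (z : R[i]) x : complex.Re `|z *: x| = complex.Re `|z| * complex.Re `|x|.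
Proof. by rewrite normrZ -(Re_normCK z) ReZ. Qed.

Lemma Re_normB x y : complex.Re `|x - y| = complex.Re `|y - x|.
Proof. by rewrite distrC. Qed.

Lemma Re_norm_eq0 x : complex.Re `|x| = 0 -> x = 0.
Proof. by move=> h; apply/eqP; rewrite -normr_eq0 -Re_normK h. Qed.

Lemma Re_norm0 : complex.Re `|0 : H| = 0.
Proof. by rewrite normr0. Qed.

Lemma Re_norm_lt x (e : R) : (complex.Re `|x| < e) = (`|x| < e%:C%C).
Proof. by rewrite -Re_normK ltcR. Qed.

Lemma Re_norm_lipschitz x y : `|complex.Re `|x| - complex.Re `|y| | <= complex.Re `|x - y|.
Proof.
have t (u v : H) : complex.Re `|u| - complex.Re `|v| <= complex.Re `|u - v|.
  by rewrite lerBlDr (le_trans _ (Re_normD _ _))// subrK.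
by rewrite ler_norml t andbT lerNl opprB Re_normB t.
Qed.

End real_normed.

Section hilbert.
Variables (R : realType) (H : completeNormedModType R[i]).
Variable dot : {dot H for (@Num.conj R[i])}.
Hypothesis hd : norm_from_dot dot.

(* Only real parts are used: [Im <x, y>] is [Re <x, i y>] (see [Im_dot]). *)
Definition real_dot (x y : H) : R := complex.Re (dot x y).
Local Notation N x := (complex.Re `|x|).

Local Notation rdot := real_dot.

Lemma rdotDl x y z : rdot (x + y) z = rdot x z + rdot y z.
Proof. by rewrite /real_dot linearDl /= ReD. Qed.

Lemma rdotDr x y z : rdot z (x + y) = rdot z x + rdot z y.
Proof. by rewrite /real_dot linearDr /= ReD. Qed.

Lemma rdotZl (r : R) x y : rdot (r%:C%C *: x) y = r * rdot x y.
Proof. by rewrite /real_dot linearZl_LR /= ReZ. Qed.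

Lemma dotZr (c : R[i]) x y : dot x (c *: y) = c^*%C * dot x y.
Proof. by rewrite linearZr_LR /=. Qed.

Lemma rdotZr (r : R) x y : rdot x (r%:C%C *: y) = r * rdot x y.
Proof. by rewrite /real_dot dotZr conjc_real ReZ. Qed.

Lemma rdotBl x y z : rdot (x - y) z = rdot x z - rdot y z.
Proof. by rewrite -[- y]scaleN1r rdotDl (_ : -1 = (-1)%:C%C) ?rdotZl ?mulN1r// rmorphN1. Qed.

Lemma rdotBr x y z : rdot z (x - y) = rdot z x - rdot z y.
Proof. by rewrite -[- y]scaleN1r rdotDr (_ : -1 = (-1)%:C%C) ?rdotZr ?mulN1r// rmorphN1. Qed.

Lemma rdotC x y : rdot x y = rdot y x.
Proof.
rewrite /real_dot; have := @hermC _ false (@Num.conj R[i]) H dot x y.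
rewrite expr0 mul1r => ->; exact: Re_conjc.
Qed.

Lemma rdot0l x : rdot 0 x = 0.
Proof. by rewrite /real_dot linear0l. Qed.

Lemma rdot_norm x : rdot x x = N x ^+ 2.
Proof. by rewrite /real_dot -hd -Re_normK expr2 ReZ expr2. Qed.

Lemma Im_dot x y : complex.Im (dot x y) = rdot x ('i%C *: y).
Proof. by rewrite /real_dot dotZr ReM /= mul0r sub0r mulN1r opprK. Qed.

Lemma real_dot_CauchySchwarz x y : `|rdot x y| <= N x * N y.
Proof.
have main u v : rdot u v <= N u * N v.
  have [/Re_norm_eq0 ->|v0] := eqVneq (N v) 0.
    by rewrite rdotC rdot0l mulr_ge0 ?Re_norm_ge0.
  have vp : 0 < N v by rewrite lt_def v0 Re_norm_ge0.
  (* The factor [N u / N v] rescales [v] to the length of [u]; the square then expands to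
     [2 (N u / N v) (N u N v - <u, v>)], whose sign is that of the last factor once [u] is
     nonzero. *)
  have : 0 <= rdot (u - (N u / N v)%:C%C *: v) (u - (N u / N v)%:C%C *: v).
    by rewrite rdot_norm sqr_ge0.
  rewrite !(rdotBl, rdotBr) !rdotZl !rdotZr !rdot_norm (rdotC v u).
  have -> : N u ^+ 2 - N u / N v * rdot u v -
    (N u / N v * rdot u v - N u / N v * (N u / N v * N v ^+ 2)) =
    2 * (N u / N v) * (N u * N v - rdot u v).
    by field.
  have [u0|u0] := eqVneq (N u) 0.
    by move=> _; rewrite (Re_norm_eq0 u0) rdot0l Re_norm0 mul0r.
  have up : 0 < N u by rewrite lt_def u0 Re_norm_ge0.
  by rewrite pmulr_rge0 ?subr_ge0// mulr_gt0// ?divr_gt0.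
rewrite ler_norml main andbT lerNl.
have := main (- x) y; rewrite normrN; apply: le_trans.
by rewrite -[- x]sub0r rdotBl rdot0l sub0r.
Qed.

(** The representing vector is the minimiser of [J x = |x|^2 - 2 L x], and the identity is the
    vanishing of the first variation of [J] there. Only real linearity of [L] enters, which matches
    the use of real parts. *)
Lemma riesz (L : H -> R) (M : R) :
  (forall x y, L (x + y) = L x + L y) ->
  (forall r x, L (r%:C%C *: x) = r * L x) ->
  (forall x, `|L x| <= M * N x) ->
  exists h, forall x, rdot h x = L x.
Proof.
move=> LD LZ LM.
pose J x := N x ^+ 2 - 2 * L x.
have lb : has_lbound (range J).
  exists (- M ^+ 2) => _ [x _ <-]; rewrite /J.
  have : L x <= M * N x by apply: le_trans (LM x); exact: ler_norm.
  have := sqr_ge0 (N x - M); nra.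
have hi : has_inf (range J) by split => //; exists (J 0); exists 0.
pose j := inf (range J).
have jle x : j <= J x by apply: ge_inf => //; exists x.
have ex n : exists x, J x < j + n.+1%:R^-1.
  have [|_ [x _ <-] ?] := @inf_adherent _ (range J) n.+1%:R^-1 _ hi; last by exists x.
  by rewrite invr_gt0.
have [e eP] := choice ex.
(* By the parallelogram law a minimising sequence of [J] is Cauchy. *)
have par n m : N (e n - e m) ^+ 2 <= 2 * n.+1%:R^-1 + 2 * m.+1%:R^-1.
  have := jle (2^-1%:C%C *: (e n + e m)).
  have := eP n; have := eP m; rewrite /J LZ LD -!rdot_norm.
  rewrite rdotZl rdotZr !rdotBl !rdotBr !rdotDl !rdotDr (rdotC (e m) (e n)).
  move: n.+1%:R^-1 m.+1%:R^-1 => p q; lra.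
have small (r : R) : 0 < r -> exists n, forall m, (n <= m)%N -> m.+1%:R^-1 < r.
  move=> r0; have [n nP] := ltr_add_invr r0; rewrite add0r in nP.
  exists n => m nm; apply: le_lt_trans nP.
  by rewrite lef_pV2 ?posrE ?ltr0n// ler_nat ltnS.
have ce : cauchy (e n @[n --> \oo]).
  apply: cauchy_exP => eps eps0.
  (* A positive element of [R[i]] is real. *)
  have rE : (complex.Re eps)%:C%C = eps.
    by move: eps0; rewrite ltcE => /andP[/eqP i0 _]; apply: eq_complex_ReIm.
  have r0 : 0 < complex.Re eps by move: eps0; rewrite ltcE => /andP[].
  have [n nP] := small (complex.Re eps ^+ 2 / 4) ltac:(by rewrite divr_gt0// exprn_gt0).
  exists (e n); exists n => // m /= nm; rewrite -ball_normE /=.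
  rewrite -rE -Re_norm_lt -(@ltr_pXn2r _ 2) ?nnegrE ?Re_norm_ge0 ?ltW//.
  apply: le_lt_trans (par _ _) _.
  have := nP _ nm; have := nP _ (leqnn n); move: n.+1%:R^-1 m.+1%:R^-1 => p q; lra.
have /cvg_ex [h hP] : cvg (e n @[n --> \oo]) by apply: cauchy_cvg.
have app (r : R) : 0 < r -> exists m, N (h - e m) < r /\ m.+1%:R^-1 < r.
  move=> r0; have [n nP] := small r r0.
  have /cvgrPdist_lt /(_ r%:C%C) [|k _ kP] := hP; first by rewrite ltcR.
  exists (maxn n k); split; last by apply: nP; rewrite leq_maxl.
  by rewrite Re_norm_lt; apply: kP; rewrite /= leq_maxr.
exists h => x.
(* The right side is [J (h + t x) - J h]. Continuity of [J] is not invoked: if the value [E] were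
   negative, some [e m] close enough to [h] would satisfy [J (e m + t x) < j]. *)
have key t : 0 <= 2 * t * (rdot h x - L x) + t ^+ 2 * N x ^+ 2.
  rewrite leNgt; apply/negP; set E := (X in X < 0) => E0.
  have c0 : 0 < 1 + 2 * `|t| * N x.
    by rewrite ltr_wpDr// !mulr_ge0 ?Re_norm_ge0.
  (* Two errors have to fit into [- E]: [r] from [J (e m) < j + r], and [2 |t| r N x] from replacing
     [h] by [e m] in the inner product. *)
  have [r r0 rE] : exists2 r, 0 < r & r * (1 + 2 * `|t| * N x) = - E.
    exists (- E / (1 + 2 * `|t| * N x)); first by rewrite divr_gt0// oppr_gt0.
    by rewrite divfK// gt_eqF.
  have [m [m1 m2]] := app r r0.
  have := jle (e m + t%:C%C *: x); have := eP m.
  rewrite /J LD LZ -!rdot_norm !rdotDl !rdotDr !rdotZl !rdotZr (rdotC x).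
  have : `|t * rdot (h - e m) x| <= `|t| * (r * N x).
    rewrite normrM ler_wpM2l// (le_trans (real_dot_CauchySchwarz _ _))// ler_wpM2r ?Re_norm_ge0//.
    exact: ltW.
  rewrite rdotBl ler_norml => /andP[l1 l2].
  move: rE m2; rewrite /E -!rdot_norm; clear E E0.
  move: m.+1%:R^-1 => p rE m2; nra.
have q0 : 0 < N x ^+ 2 + 1 by rewrite ltr_wpDl// sqr_ge0.
(* Up to the [+ 1], which avoids dividing by zero, this [t] minimises the quadratic in [key]. Its
   value there is [- a^2 (q + 2) / (q + 1)^2], so [a] must vanish. *)
have := key (- (rdot h x - L x) / (N x ^+ 2 + 1)).
set a := rdot h x - L x; set q := N x ^+ 2 => kq.
suff : a ^+ 2 <= 0 by rewrite exprn_even_le0//= subr_eq0 => /eqP.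
have -> : a ^+ 2 = - (2 * (- a / (q + 1)) * a + (- a / (q + 1)) ^+ 2 * q) * ((q + 1) ^+ 2 / (q + 2)).
  field; rewrite !gt_eqF//; rewrite -/q in q0; lra.
rewrite mulNr oppr_le0 mulr_ge0// divr_ge0 ?sqr_ge0//; rewrite -/q in q0; lra.
Qed.
End hilbert.

(** * Square integrable functions and weak integrals *)

Section square_integrable.
Context d (Z : measurableType d) (R : realType) (m : {measure set Z -> \bar R}).
Implicit Types f g u : Z -> R.
Local Notation intg f := (m.-integrable setT (EFin \o f)).

Lemma sqr_normr (x : R) : `|x| ^+ 2 = x ^+ 2.
Proof. by rewrite real_normK// num_real. Qed.

Lemma measurable_fun_rays f : (forall a, measurable [set z | f z < a]) ->
  measurable_fun setT f.
Proof.
move=> h; apply: (measurability _ (RGenInftyO.measurableE R)) => _ [_ [a ->] <-].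
by rewrite setTI; apply: eq_rect (h a) _ _; apply/seteqP; split => z /=; rewrite in_itv.
Qed.

Definition sqint f := measurable_fun setT f /\ intg (fun z => f z ^+ 2).

Lemma le_intg f g : measurable_fun setT f -> (forall z, `|f z| <= g z) -> intg g ->
  intg f.
Proof.
move=> mf fg; apply: le_integrable => //; first exact/measurable_EFinP.
by move=> z _ /=; rewrite lee_fin (le_trans (fg z))// ler_norm.
Qed.

Lemma sqintP f : measurable_fun setT f ->
  (\int[m]_z (f z ^+ 2)%:E < +oo)%E -> sqint f.
Proof.
move=> mf h; split=> //; apply/integrableP; split.
  by apply/measurable_EFinP; exact: measurable_funX.
apply: le_lt_trans h; rewrite le_eqVlt; apply/orP; left; apply/eqP.
by apply: eq_integral => z _ /=; rewrite ger0_norm// sqr_ge0.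
Qed.

Lemma intg_add f g : intg f -> intg g -> intg (fun z => f z + g z).
Proof. by move=> hf hg; exact: (integrableD measurableT hf hg). Qed.

Lemma intg_sub f g : intg f -> intg g -> intg (fun z => f z - g z).
Proof. by move=> hf hg; exact: (integrableB measurableT hf hg). Qed.

Lemma intg_scale r f : intg f -> intg (fun z => r * f z).
Proof. by move=> hf; exact: (integrableZl measurableT r hf). Qed.

Lemma sqint_mul f g : sqint f -> sqint g -> intg (fun z => f z * g z).
Proof.
move=> [mf hf] [mg hg]; apply: le_intg (intg_add hf hg).
  exact: measurable_funM.
move=> z; rewrite normrM -[f z ^+ 2]sqr_normr -[g z ^+ 2]sqr_normr.
have := sqr_ge0 (`|f z| - `|g z|); have := normr_ge0 (f z); have := normr_ge0 (g z).
nra.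
Qed.

Lemma le_sqint f g C : measurable_fun setT f -> (forall z, `|f z| <= C * g z) ->
  sqint g -> sqint f.
Proof.
move=> mf fg [mg hg]; split=> //; apply: le_intg (intg_scale (C ^+ 2) hg).
  exact: measurable_funX.
move=> z; rewrite ger0_norm ?sqr_ge0// -exprMn -sqr_normr ler_sqr ?nnegrE//.
by apply: le_trans (fg z).
Qed.

Lemma sqintD f g : sqint f -> sqint g -> sqint (fun z => f z + g z).
Proof.
move=> hf hg; split; first by apply: measurable_funD; [case: hf | case: hg].
apply: le_intg (intg_add (intg_scale 2 hf.2) (intg_scale 2 hg.2)).
  by apply: measurable_funX; apply: measurable_funD; [case: hf | case: hg].
by move=> z; rewrite ger0_norm ?sqr_ge0//; have := sqr_ge0 (f z - g z); nra.
Qed.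

Definition unit_fun u := measurable_fun setT u /\ (\int[m]_z (u z ^+ 2)%:E = 1)%E.

Lemma unit_sqint u : unit_fun u -> sqint u.
Proof. by move=> [mu u1]; apply: sqintP => //; rewrite u1 ltry. Qed.

Lemma unit_CS u f : unit_fun u -> sqint f ->
  (\int[m]_z (u z * f z)) ^+ 2 <= \int[m]_z (f z ^+ 2).
Proof.
move=> hu hf; have su := unit_sqint hu; set c := \int[m]_z (u z * f z).
have iuf := sqint_mul su hf.
(* The integrand is [(f - c u)^2]. *)
have : 0 <= \int[m]_z ((f z ^+ 2 - 2 * c * (u z * f z)) + c ^+ 2 * u z ^+ 2).
  apply: Rintegral_ge0 => z _.
  by have := sqr_ge0 (f z - c * u z); congr (_ <= _); ring.
rewrite RintegralD//; first last.
- exact: intg_scale su.2.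
- exact: intg_sub hf.2 (intg_scale _ iuf).
rewrite RintegralB//; [|exact: hf.2|exact: intg_scale].
rewrite !RintegralZl//; last exact: su.2.
have -> : \int[m]_z (u z ^+ 2) = 1 by rewrite /Rintegral hu.2.
rewrite -/c; lra.
Qed.

Lemma le_Rintegral_setT f g : intg f -> intg g -> (forall z, f z <= g z) ->
  \int[m]_z f z <= \int[m]_z g z.
Proof. by move=> hf hg fg; apply: le_Rintegral. Qed.

(** In the applications [f] is the pairing of a vector field with a fixed vector, [g] is the norm of
    the field and [C] the norm of the vector. *)
Lemma unit_CS_le u f g C : unit_fun u -> measurable_fun setT f -> 0 <= C ->
  (forall z, `|f z| <= C * g z) -> sqint g ->
  `|\int[m]_z (u z * f z)| <= C * Num.sqrt (\int[m]_z (g z ^+ 2)).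
Proof.
move=> hu mf C0 fg hg; have hf := le_sqint mf fg hg.
have I0 : 0 <= \int[m]_z (g z ^+ 2) by apply: Rintegral_ge0 => z _; exact: sqr_ge0.
rewrite -(@ler_pXn2r _ 2) ?nnegrE ?mulr_ge0 ?sqrtr_ge0//.
rewrite sqr_normr exprMn sqr_sqrtr// (le_trans (unit_CS hu hf))//.
rewrite -RintegralZl//; last exact: hg.2.
apply: le_Rintegral_setT; [exact: hf.2|exact: intg_scale hg.2|] => z.
rewrite -exprMn -sqr_normr ler_sqr ?nnegrE//.
by apply: le_trans (fg z).
Qed.

End square_integrable.

Section L2_general.
Context d (Z : measurableType d) (R : realType) (m : {measure set Z -> \bar R}).

(** Abstracting this property lets the same lemmas on functions [z |-> f(z) w] serve [H]-valued
    functions, scalar functions and kernels with values in [A]. *)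
Definition homogeneous (V : seminormed R) := forall (r : R) (w : V), dom V w ->
  dom V (r%:C%C *: w) /\ nrm V (r%:C%C *: w) = `|r| * nrm V w.

(** The function is [f] followed by [t |-> t w]. The latter is Lipschitz, so it pulls norm-open sets
    back to open subsets of the line, and measurability of [f] is enough. *)
Lemma L2_scale (V : seminormed R) (f : Z -> R) (w : V) :
  homogeneous V -> sqint m f -> dom V w ->
  dom (L2 m V) (fun z => (f z)%:C%C *: w).
Proof.
move=> hV [mf If] dw; split.
- by move=> z; have [] := hV (f z) w dw.
- move=> U oU; rewrite -[X in measurable X]setTI.
  have mU : measurable [set t : R | U (t%:C%C *: w)].
    apply: open_measurable; rewrite openE => t /= Ut.
    have [dt _] := hV t w dw; have [e e0 eU] := oU _ dt Ut.
    have c0 : 0 < `|nrm V w| + 1 by rewrite ltr_wpDl.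
    apply/nbhs_ballP; exists (e / (`|nrm V w| + 1)) => /=; first by rewrite divr_gt0.
    move=> s; rewrite /ball /= ltr_pdivlMr// => st.
    apply: eU; first by have [] := hV s w dw.
    rewrite -scalerBl -rmorphB (hV (s - t) w dw).2 distrC.
    apply: le_lt_trans st; rewrite ler_wpM2l// ler_wpDr//; exact: ler_norm.
  exact: (mf measurableT _ mU).
- have -> : (fun z => (nrm V ((f z)%:C%C *: w) ^+ 2)%:E) =
            (fun z => (nrm V w ^+ 2 * (f z) ^+ 2)%:E).
    apply/funext => z; rewrite (hV (f z) w dw).2 exprMn sqr_normr.
    by rewrite mulrC.
  apply: (@integrable_lty _ _ _ m setT measurableT).
  exact: (intg_scale (nrm V w ^+ 2) If).
Qed.

Lemma nrm_L2_scale (V : seminormed R) (u : Z -> R) (w : V) :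
  homogeneous V -> unit_fun m u -> dom V w ->
  nrm (L2 m V) (fun z => (u z)%:C%C *: w) = `|nrm V w|.
Proof.
move=> hV hu dw; rewrite /= -sqrtr_sqr; congr Num.sqrt.
transitivity (\int[m]_z (nrm V w ^+ 2 * (u z) ^+ 2)).
  by apply: eq_Rintegral => z _; rewrite (hV (u z) w dw).2 exprMn sqr_normr mulrC.
rewrite RintegralZl//; last exact: (unit_sqint hu).2.
by rewrite /Rintegral hu.2 /= mulr1.
Qed.

(** Membership in [L2] controls preimages of norm-open sets only. For a Lipschitz [phi] each set
    [phi v < a] is norm-open, which turns this into ordinary measurability of real functions. *)
Lemma measurable_lipschitz_comp (V : seminormed R) (phi : V -> R) (f : Z -> V) C :
  (forall v w, dom V v -> dom V w -> `|phi v - phi w| <= C * nrm V (v - w)) ->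
  0 < C ->
  dom (L2 m V) f ->
  measurable_fun setT (phi \o f).
Proof.
move=> lip C0 [df mf If]; apply: measurable_fun_rays => a.
apply: (mf [set v | phi v < a]) => v dv /= va.
exists ((a - phi v) / C); first by rewrite divr_gt0// subr_gt0.
move=> w dw; rewrite ltr_pdivlMr// mulrC => h.
have := lip _ _ dw dv => /(le_trans (ler_norm _)) /le_lt_trans /(_ h).
by rewrite ltrBlDr subrK.
Qed.

End L2_general.

Lemma countable_surj (T : choiceType) (x0 : T) (D : set T) : countable D ->
  exists e : nat -> T, forall x, D x -> exists n, e n = x.
Proof.
move=> /countable_injP [f fi].
exists (fun n => xget x0 [set x | D x /\ f x = n]) => x Dx; exists (f x).
case: xgetP => [y _ [Dy fy]|/(_ x) []//].
by apply: fi; rewrite ?inE.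
Qed.

Lemma dense_approx (R : realType) (H : normedModType R[i]) (D : set H) :
  dense D -> forall x (r : R), 0 < r -> exists2 c, D c & complex.Re `|x - c| < r.
Proof.
move=> dD x r r0.
have [|c [xc Dc]] := dD (ball x r%:C%C) _ (ball_open _ _).
  by exists x; apply: ballxx; rewrite ltcR.
by exists c => //; rewrite Re_norm_lt; move: xc; rewrite -ball_normE.
Qed.

Section L2_hilbert.
Context d (Z : measurableType d) (R : realType) (m : {measure set Z -> \bar R}).
Variables (H : completeNormedModType R[i]).
Variable dot : {dot H for (@Num.conj R[i])}.
Hypothesis hd : norm_from_dot dot.
Local Notation N x := (complex.Re `|x|).
Local Notation rdot := (real_dot dot).
Local Notation L2H := (L2 m (normed H)).

Lemma homogeneous_normed : homogeneous (normed H).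
Proof. by move=> r w _; split=> //=; rewrite Re_normZ Re_normC_real. Qed.

Lemma measurable_L2_norm f : dom L2H f -> measurable_fun setT (fun z => N (f z)).
Proof.
move=> hf; apply: (@measurable_lipschitz_comp _ _ _ m (normed H) (fun v : H => N v) f 1) hf => //=.
by move=> v w _ _; rewrite mul1r Re_norm_lipschitz.
Qed.

Lemma sqint_L2_norm f : dom L2H f -> sqint m (fun z => N (f z)).
Proof. by move=> hf; apply: sqintP; [exact: measurable_L2_norm | case: hf]. Qed.

Lemma sqint_L2_dot f e : dom L2H f -> sqint m (fun z => rdot (f z) e).
Proof.
move=> hf; apply: (@le_sqint _ _ _ _ _ (fun z => N (f z)) (N e + 1)); last exact: sqint_L2_norm.
- apply: (@measurable_lipschitz_comp _ _ _ m (normed H) (fun v : H => rdot v e) f (N e + 1)) hf => //=.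
  + move=> v w _ _; rewrite -rdotBl (le_trans (real_dot_CauchySchwarz hd _ _))//.
    by rewrite mulrC ler_wpM2r ?Re_norm_ge0// ler_wpDr.
  + by rewrite ltr_wpDl ?Re_norm_ge0.
- move=> z; rewrite (le_trans (real_dot_CauchySchwarz hd _ _))//.
  by rewrite mulrC ler_wpM2r ?Re_norm_ge0// ler_wpDr.
Qed.

(** Testing against [i e] recovers the imaginary part of the pairing with [e], so the real
    identities for all [e] carry the whole complex statement. *)
Lemma is_integral_HP (f : Z -> H) (v : H) :
  (forall e, m.-integrable setT (EFin \o (fun z => rdot (f z) e)) /\
    rdot v e = \int[m]_z rdot (f z) e) <-> is_integral_H dot m f v.
Proof.
split=> h e.
  have [i1 e1] := h e; have [i2 e2] := h ('i%C *: e).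
  have E : (fun z => complex.Im (dot (f z) e)) = (fun z => rdot (f z) ('i%C *: e)).
    by apply/funext => z; rewrite Im_dot.
  split; first by split=> //; have := i2; congr (m.-integrable setT _); apply/funext => z /=; rewrite Im_dot.
  by apply: eq_complex_ReIm; rewrite /= ?E// Im_dot.
by have [[i1 _] E] := h e; split=> //; rewrite /real_dot E.
Qed.

Lemma integral_H_uniq (f : Z -> H) (v w : H) :
  is_integral_H dot m f v -> is_integral_H dot m f w -> v = w.
Proof.
move=> /is_integral_HP hv /is_integral_HP hw.
apply/eqP; rewrite -subr_eq0; apply/eqP; apply: Re_norm_eq0; apply/eqP.
rewrite -sqrf_eq0 -(rdot_norm hd) rdotBl.
by rewrite (hv _).2 (hw _).2 subrr.
Qed.

(** By the Cauchy-Schwarz inequality, [e |-> int u <xi, e>] is bounded by the [L2] norm of [xi]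
    times the norm of [e]; the Riesz representation supplies the vector. *)
Lemma weak_integral_ex u xi : unit_fun m u -> dom L2H xi ->
  exists v, is_integral_H dot m (fun z => (u z)%:C%C *: xi z) v.
Proof.
move=> hu hxi.
have su := unit_sqint hu.
have ii e : m.-integrable setT (EFin \o (fun z => u z * rdot (xi z) e)).
  by apply: sqint_mul => //; exact: sqint_L2_dot.
have [|||h hP] := @riesz R H dot hd (fun e => \int[m]_z (u z * rdot (xi z) e))
   (Num.sqrt (\int[m]_z (N (xi z) ^+ 2))).
- move=> x y; rewrite -RintegralD//; apply: eq_Rintegral => z _.
  by rewrite rdotDr mulrDr.
- move=> r x; rewrite -RintegralZl//; apply: eq_Rintegral => z _.
  by rewrite rdotZr mulrCA.
- move=> x; rewrite mulrC; apply: unit_CS_le => //.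
  + by have [] := sqint_L2_dot x hxi.
  + exact: Re_norm_ge0.
  + by move=> z; rewrite mulrC real_dot_CauchySchwarz.
  + exact: sqint_L2_norm.
exists h; apply/is_integral_HP => e; rewrite hP; split.
  by have := ii e; congr (m.-integrable setT _); apply/funext => z /=; rewrite rdotZl.
by apply: eq_Rintegral => z _; rewrite rdotZl.
Qed.

(** Testing the integral against [v] itself gives [|v|^2 = int u <xi, v>], which is at most [|v|]
    times the [L2] norm of [xi]. *)
Lemma weak_integral_le u xi v : unit_fun m u -> dom L2H xi ->
  is_integral_H dot m (fun z => (u z)%:C%C *: xi z) v -> N v <= nrm L2H xi.
Proof.
move=> hu hxi /is_integral_HP /(_ v) [_].
have [-> _|v0] := eqVneq (N v) 0; first by rewrite sqrtr_ge0.
have vp : 0 < N v by rewrite lt_def v0 Re_norm_ge0.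
rewrite (rdot_norm hd) => e; rewrite -(ler_pM2l vp) -expr2 e.
apply: le_trans (ler_norm _) _.
rewrite (_ : (fun z => _) = (fun z => u z * rdot (xi z) v)); last first.
  by apply/funext => z; rewrite rdotZl.
apply: unit_CS_le => //.
+ by have [] := sqint_L2_dot v hxi.
+ exact: Re_norm_ge0.
+ by move=> z; rewrite mulrC real_dot_CauchySchwarz.
+ exact: sqint_L2_norm.
Qed.

Hypothesis sepH : separable_space H.

Lemma sqint_L2_dist f g : dom L2H f -> dom L2H g -> sqint m (fun z => N (f z - g z)).
Proof.
move=> hf hg; apply: (le_sqint (C := 1)) (sqintD (sqint_L2_norm hf) (sqint_L2_norm hg)); last first.
  move=> z; rewrite (ger0_norm (Re_norm_ge0 _)) mul1r.
  by rewrite (le_trans (Re_normD _ _))// normrN.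
have [D cD dD] := sepH; have [s sP] := @countable_surj H 0 D cD.
apply: measurable_fun_rays => a.
have mc h (c : H) : dom L2H h -> measurable_fun setT (fun z => N (h z - c)).
  move=> hh; apply: (@measurable_lipschitz_comp _ _ _ m (normed H) (fun v : H => N (v - c)) h 1) hh => //=.
  move=> v w _ _; rewrite mul1r (le_trans (Re_norm_lipschitz _ _))//.
  by rewrite opprB addrA subrK.
(* Measurability of a difference of [H]-valued functions uses separability. *)
have -> : [set z | N (f z - g z) < a] =
    \bigcup_n [set z | N (f z - s n) + N (g z - s n) < a].
  apply/seteqP; split => z /=.
    move=> fga; have [|c Dc gc] := @dense_approx R H D dD (g z) ((a - N (f z - g z)) / 2).
      by rewrite divr_gt0// subr_gt0.
    have [n nc] := sP c Dc; exists n => //=; rewrite nc; have := Re_normD (f z - g z) (g z - c).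
    rewrite addrA subrK; move: gc; rewrite ltr_pdivlMr//.
    lra.
  move=> [n _ /=]; apply: le_lt_trans.
  by rewrite (Re_normB (g z)) (le_trans _ (Re_normD _ _))// addrA subrK.
apply: bigcupT_measurable => n.
have := measurable_funD (mc f (s n) hf) (mc g (s n) hg) => mfg.
rewrite -[X in measurable X]setTI.
apply: (mfg measurableT [set t | t < a]).
by apply: open_measurable; exact: open_lt.
Qed.

End L2_hilbert.

(** * Bounded operators on a Hilbert space *)

Section bounded_operators.
Variables (R : realType) (H : completeNormedModType R[i]).
Local Notation N x := (complex.Re `|x|).
Implicit Types a b : BH H.

(** The sign of [c] matters because the unit ball may be empty, in which case [sup] is [0]. *)
Lemma opnorm_le (V W : seminormed R) (T : V -> W) c : 0 <= c ->
  (forall v, dom V v -> nrm V v <= 1 -> nrm W (T v) <= c) -> opnorm T <= c.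
Proof.
move=> c0 h; rewrite /opnorm; set S := (X in sup X).
have [->|/set0P ne] := eqVneq S set0; first by rewrite sup0.
by apply: ge_sup => // _ [v [dv v1] <-]; exact: h.
Qed.

(** The constant [c] certifies that the supremum is taken over a bounded set; its value does not
    reach the conclusion. *)
Lemma opnorm_ge (V W : seminormed R) (T : V -> W) c v :
  (forall v, dom V v -> nrm V v <= 1 -> nrm W (T v) <= c) ->
  dom V v -> nrm V v <= 1 -> nrm W (T v) <= opnorm T.
Proof.
move=> h dv v1; apply: ub_le_sup; last by exists v.
by exists c => _ [w [dw w1] <-]; exact: h.
Qed.

(** Linearity modulo vectors of norm zero is genuine linearity here, since the norm of [H] separates
    points. *)
Lemma BH_lin a (c : R[i]) u v : dom (BH H) a -> a (c *: u + v) = c *: a u + a v.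
Proof.
move=> [_ h _]; apply/eqP; rewrite -subr_eq0; apply/eqP; apply: Re_norm_eq0.
exact: h.
Qed.

Lemma BH_D a u v : dom (BH H) a -> a (u + v) = a u + a v.
Proof. by move=> da; rewrite -{1}[u]scale1r BH_lin// scale1r. Qed.

Lemma BH_0 a : dom (BH H) a -> a 0 = 0.
Proof.
move=> da; have := BH_D 0 0 da; rewrite addr0 => /eqP.
by rewrite -subr_eq subrr => /eqP.
Qed.

Lemma BH_Z a c u : dom (BH H) a -> a (c *: u) = c *: a u.
Proof. by move=> da; rewrite -{1}[c *: u]addr0 BH_lin// BH_0// addr0. Qed.

Lemma BH_opnorm_ge a v : dom (BH H) a -> N v <= 1 -> N (a v) <= opnorm a.
Proof.
move=> [_ _ [c hc]] v1.
apply: (@opnorm_ge (normed H) (normed H) a `|c|) => //= w _ w1.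
apply: le_trans (hc w _) _ => //=.
apply: le_trans (ler_norm _) _; rewrite normrM -[leRHS]mulr1.
by rewrite ler_wpM2l// ger0_norm// Re_norm_ge0.
Qed.

Lemma BH_le a x : dom (BH H) a -> N (a x) <= opnorm a * N x.
Proof.
move=> da; have [/Re_norm_eq0 ->|x0] := eqVneq (N x) 0.
  by rewrite BH_0// Re_norm0 mulr0.
have xp : 0 < N x by rewrite lt_def x0 Re_norm_ge0.
rewrite -ler_pdivrMr//.
have -> : N (a x) / N x = N (a ((N x)^-1%:C%C *: x)).
  by rewrite BH_Z// Re_normZ Re_normC_real ger0_norm ?invr_ge0 ?Re_norm_ge0// mulrC.
apply: BH_opnorm_ge => //.
by rewrite Re_normZ Re_normC_real ger0_norm ?invr_ge0 ?Re_norm_ge0// mulVf.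
Qed.

Lemma opnorm_ge0 a : dom (BH H) a -> 0 <= opnorm a.
Proof.
move=> da; apply: le_trans (Re_norm_ge0 (a 0)) _; by apply: BH_opnorm_ge => //; rewrite Re_norm0.
Qed.

Lemma dom_BH_Z (r : R[i]) a : dom (BH H) a -> dom (BH H) (r *: a).
Proof.
move=> da; split=> //.
- move=> c u v _ _; rewrite (_ : _ - _ = 0) ?Re_norm0//=; first exact: Re_norm0.
  rewrite [X in X - _](_ : _ = r *: a (c *: u + v))//.
  rewrite BH_lin// scalerDr [X in _ - X](_ : _ = c *: (r *: a u) + r *: a v)//.
  by rewrite !scalerA mulrC subrr.
- exists (complex.Re `|r| * opnorm a) => v _ /=.
  by rewrite Re_normZ -mulrA; apply: ler_wpM2l; [exact: Re_normC_ge0 | exact: BH_le].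
Qed.

Lemma opnormZ (r : R) a : dom (BH H) a -> opnorm (r%:C%C *: a : BH H) = `|r| * opnorm a.
Proof.
have le1 (s : R) b : dom (BH H) b -> opnorm (s%:C%C *: b : BH H) <= `|s| * opnorm b.
  move=> db; apply: opnorm_le => [|v _ v1]; first by rewrite mulr_ge0// opnorm_ge0.
  rewrite /= Re_normZ Re_normC_real ler_wpM2l// (le_trans (BH_le _ db))//.
  by rewrite -[leRHS]mulr1 ler_wpM2l// opnorm_ge0.
move=> da; apply/eqP; rewrite eq_le le1//=.
have [->|r0] := eqVneq r 0; first by rewrite normr0 mul0r opnorm_ge0//; exact: dom_BH_Z.
rewrite -ler_pdivlMl ?normr_gt0// -normfV.
rewrite -{1}[a]scale1r (_ : 1 = r^-1%:C%C * r%:C%C); last first.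
  by rewrite -rmorphM mulVf.
by rewrite -scalerA le1//; exact: dom_BH_Z.
Qed.

End bounded_operators.

(** * Rank one operators *)

Section scalar_functional.
Context d (Z : measurableType d) (R : realType) (m : {measure set Z -> \bar R}).
Variable u : Z -> R.
Hypothesis hu : unit_fun m u.
Local Notation L2C := (L2 m (scalars R)).
Implicit Types f g : Z -> R[i].

Definition pair_scalar f : R[i] := integral_C m (fun z => (u z)%:C%C * f z).

Lemma homogeneous_scalars : homogeneous (scalars R).
Proof. move=> r w _; split=> //=; rewrite -Re_normC_real; exact: Re_normCM. Qed.

Let Nlip (z w : R[i]) : `|complex.Re `|z| - complex.Re `|w| | <= complex.Re `|z - w|.
Proof. exact: (@Re_norm_lipschitz R (R[i]^o) z w). Qed.

Lemma sqint_scalar_norm f : dom L2C f -> sqint m (fun z => complex.Re `|f z|).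
Proof.
move=> hf; apply: sqintP; last by case: hf.
apply: (@measurable_lipschitz_comp _ _ _ m (scalars R) (fun v : R[i] => complex.Re `|v|) f 1) hf => //=.
by move=> v w _ _; rewrite mul1r; exact: Nlip.
Qed.

Lemma measurable_scalar_Re f : dom L2C f -> measurable_fun setT (fun z => complex.Re (f z)).
Proof.
move=> hf.
apply: (@measurable_lipschitz_comp _ _ _ m (scalars R) (fun v : R[i] => complex.Re v) f 1) hf => //=.
by move=> v w _ _; rewrite mul1r -ReB normr_Re_le.
Qed.

Lemma measurable_scalar_Im f : dom L2C f -> measurable_fun setT (fun z => complex.Im (f z)).
Proof.
move=> hf.
apply: (@measurable_lipschitz_comp _ _ _ m (scalars R) (fun v : R[i] => complex.Im v) f 1) hf => //=.
by move=> v w _ _; rewrite mul1r -ImB normr_Im_le.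
Qed.

Lemma integrable_scalar_Re f : dom L2C f ->
  m.-integrable setT (EFin \o (fun z => u z * complex.Re (f z))).
Proof.
move=> hf; apply: sqint_mul; first exact: unit_sqint.
apply: (le_sqint (C := 1)) (sqint_scalar_norm hf); first exact: measurable_scalar_Re.
by move=> z; rewrite mul1r normr_Re_le.
Qed.

Lemma integrable_scalar_Im f : dom L2C f ->
  m.-integrable setT (EFin \o (fun z => u z * complex.Im (f z))).
Proof.
move=> hf; apply: sqint_mul; first exact: unit_sqint.
apply: (le_sqint (C := 1)) (sqint_scalar_norm hf); first exact: measurable_scalar_Im.
by move=> z; rewrite mul1r normr_Im_le.
Qed.

Lemma pair_scalarE f : pair_scalar f =
  ((\int[m]_z (u z * complex.Re (f z))) +i* (\int[m]_z (u z * complex.Im (f z))))%C.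
Proof.
by rewrite /pair_scalar /integral_C; congr (_ +i* _)%C; apply: eq_Rintegral => z _;
  rewrite ?ReZ ?ImZ.
Qed.

Lemma pair_scalar_lin (c : R[i]) f g : dom L2C f -> dom L2C g ->
  pair_scalar (fun z => c * f z + g z) = c * pair_scalar f + pair_scalar g.
Proof.
move=> hf hg; have fR := integrable_scalar_Re hf; have fI := integrable_scalar_Im hf.
have gR := integrable_scalar_Re hg; have gI := integrable_scalar_Im hg.
rewrite !pair_scalarE; apply: eq_complex_ReIm; rewrite ?ReD ?ImD ?ReM ?ImM /=.
  rewrite -!RintegralZl// -RintegralB//; [|exact: intg_scale|exact: intg_scale].
  rewrite -RintegralD//; last by apply: intg_sub; exact: intg_scale.
  by apply: eq_Rintegral => z _; rewrite ReD ReM; ring.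
rewrite -!RintegralZl// -RintegralD//; [|exact: intg_scale|exact: intg_scale].
rewrite -RintegralD//; last by apply: intg_add; exact: intg_scale.
by apply: eq_Rintegral => z _; rewrite ImD ImM; ring.
Qed.

Lemma pair_scalar_le f : dom L2C f ->
  `|complex.Re (pair_scalar f)| <= nrm L2C f /\
  `|complex.Im (pair_scalar f)| <= nrm L2C f.
Proof.
move=> hf; rewrite pair_scalarE /=; split.
  rewrite -[leRHS]mul1r; apply: unit_CS_le => //; last exact: sqint_scalar_norm; first exact: measurable_scalar_Re.
  by move=> z; rewrite mul1r normr_Re_le.
rewrite -[leRHS]mul1r; apply: unit_CS_le => //; last exact: sqint_scalar_norm; first exact: measurable_scalar_Im.
by move=> z; rewrite mul1r normr_Im_le.
Qed.

End scalar_functional.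

Lemma homo_ltn_le (s : nat -> nat) n : {homo s : m n / (m < n)%N} -> (n <= s n)%N.
Proof.
by move=> hs; elim: n => // n IH; apply: leq_ltn_trans IH (hs _ _ (ltnSn n)).
Qed.

Lemma homo_ltn_cvgoo (s : nat -> nat) : {homo s : m n / (m < n)%N} ->
  s n @[n --> \oo] --> \oo.
Proof.
move=> hs A [n _ nA]; exists n => // m /= nm; apply: nA => /=.
by rewrite (leq_trans nm)// homo_ltn_le.
Qed.

Lemma bolzano_weierstrass_C (R : realType) (z : nat -> R[i]) :
  (forall n, `|complex.Re (z n)| <= 1 /\ `|complex.Im (z n)| <= 1) ->
  exists s : nat -> nat, {homo s : m n / (m < n)%N} /\
    exists c : R[i], complex.Re `|z (s n) - c| @[n --> \oo] --> (0 : R).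
Proof.
move=> hz.
have bd (x : nat -> R) : (forall n, `|x n| <= 1) -> bounded_fun x.
  move=> hx; exists 1; split; first exact: num_real.
  by move=> M M1 n _; rewrite /= (le_trans (hx n))// ltW.
have [s1 i1 c1] := bolzano_weierstrass (bd (fun n => complex.Re (z n)) (fun n => (hz n).1)).
(* A second extraction, along [s1], makes the imaginary parts converge as well. *)
have [s2 i2 c2] := bolzano_weierstrass (bd (fun n => complex.Im (z (s1 n))) (fun n => (hz (s1 n)).2)).
have {}i1 : {mono s1 : m n / (m <= n)%N} by exact: i1.
have {}i2 : {mono s2 : m n / (m <= n)%N} by exact: i2.
exists (s1 \o s2); split.
  by move=> m n mn /=; rewrite (leqW_mono i1) (leqW_mono i2).
move: c1 c2 => /cvg_ex [a ha] /cvg_ex [b hb].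
have hs2 : s2 n @[n --> \oo] --> \oo.
  by apply: homo_ltn_cvgoo => m n mn; rewrite (leqW_mono i2).
have {}ha : complex.Re (z (s1 (s2 n))) @[n --> \oo] --> a.
  exact: (cvg_comp _ _ hs2 ha).
exists (a +i* b)%C.
have h0 : `|complex.Re (z (s1 (s2 n))) - a| + `|complex.Im (z (s1 (s2 n))) - b|
    @[n --> \oo] --> (0 : R).
  rewrite -[0 in X in _ --> X]addr0.
  by apply: cvgD; rewrite -(normr0 R); apply: cvg_norm; apply/subr_cvg0.
apply: (squeeze_cvgr _ (cvg_cst 0) h0).
near=> n; rewrite Re_normC_ge0 /= (le_trans (Re_normC_le _))//.
by rewrite ReB ImB.
Unshelve. all: by end_near.
Qed.

Lemma L2_nrm0 d (Z : measurableType d) (R : realType) (m : {measure set Z -> \bar R})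
  (V : seminormed R) (f : Z -> V) : (forall z, nrm V (f z) = 0) -> nrm (L2 m V) f = 0.
Proof.
move=> f0 /=; rewrite (_ : (fun z => _) = cst 0).
  by rewrite /Rintegral integral0 sqrtr0.
by apply/funext => z; rewrite f0 expr0n.
Qed.

Section rank_one.
Variables (R : realType) (dX dY : measure_display).
Variables (X : measurableType dX) (Y : measurableType dY).
Variables (mu : {sigma_finite_measure set X -> \bar R}).
Variables (nu : {sigma_finite_measure set Y -> \bar R}).
Variables (H : completeNormedModType R[i]) (dot : {dot H for (@Num.conj R[i])}).
Hypothesis hd : norm_from_dot dot.
Variables (A : set (BH H)).
Hypothesis hA : Cstar_subalgebra dot A.
Local Notation N x := (complex.Re `|x|).
Local Notation rdot := (real_dot dot).
Variables (u : X -> R) (v : Y -> R) (a : BH H).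
Hypotheses (hu : unit_fun mu u) (hv : unit_fun nu v) (Aa : A a).

Let da : dom (BH H) a.
Proof. by have [sA _ _ _ _] := hA; exact: sA. Qed.

(** A choice of the integral of [u xi], with default [0] when there is none; for square integrable
    [xi] it exists and is unique. *)
Definition weak_integral (xi : X -> H) : H :=
  xget 0 [set w | is_integral_H dot mu (fun x => (u x)%:C%C *: xi x) w].

Lemma weak_integralP xi : dom (L2 mu (normed H)) xi ->
  is_integral_H dot mu (fun x => (u x)%:C%C *: xi x) (weak_integral xi).
Proof.
move=> /(weak_integral_ex hd hu) [w hw].
by rewrite /weak_integral; case: xgetP => [y _ //|/(_ w)].
Qed.

Lemma weak_integralE xi w :
  is_integral_H dot mu (fun x => (u x)%:C%C *: xi x) w -> weak_integral xi = w.
Proof.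
move=> hw; rewrite /weak_integral; case: xgetP => [y _ hy|/(_ w)//].
exact: integral_H_uniq hy hw.
Qed.

(** This is the tensor product of the rank one operator [f |-> <f, u> v] with [a]. Applying [a]
    after the integration means that only the integral of [u xi] has to exist. *)
Definition rank1 : ops H mu nu := fun xi y => (v y)%:C%C *: a (weak_integral xi).

Definition rank1_kernel : Y * X -> BH H := fun z => (v z.1 * u z.2)%:C%C *: a.

Lemma rank1_nrm xi : nrm (L2 nu (normed H)) (rank1 xi) = N (a (weak_integral xi)).
Proof.
rewrite (nrm_L2_scale (@homogeneous_normed R H) hv) ?ger0_norm//; exact: Re_norm_ge0.
Qed.

Lemma rank1_le xi : dom (L2 mu (normed H)) xi ->
  nrm (L2 nu (normed H)) (rank1 xi) <= opnorm a * nrm (L2 mu (normed H)) xi.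
Proof.
move=> dxi; rewrite rank1_nrm (le_trans (BH_le _ da))// ler_wpM2l ?opnorm_ge0//.
exact: (weak_integral_le hd hu dxi (weak_integralP dxi)).
Qed.

Lemma rank1_dom : dom (ops H mu nu) rank1.
Proof.
split.
- move=> xi dxi; apply: (L2_scale (@homogeneous_normed R H)) => //; exact: unit_sqint.
- move=> c f g df dg; apply: L2_nrm0 => y.
  rewrite (_ : _ y = 0); first exact: Re_norm0.
  have E : weak_integral (c *: f + g) = c *: weak_integral f + weak_integral g.
    apply: weak_integralE; apply/is_integral_HP => e.
    have /is_integral_HP wf := weak_integralP df.
    have /is_integral_HP wg := weak_integralP dg.
    have [[f1 fE] [f2 fE'] [g1 gE]] := And3 (wf e) (wf ('i%C *: e)) (wg e).
    (* A complex scalar mixes the tests against [e] and [i e]; this formula reduces complex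
       linearity of the weak integral to real linearity of ordinary integrals. *)
    have rlin w w' : rdot (c *: w + w') e =
      complex.Re c * rdot w e - complex.Im c * rdot w ('i%C *: e) + rdot w' e.
      by rewrite rdotDl /real_dot linearZl_LR /= ReM Im_dot.
    rewrite rlin fE fE' gE.
    have -> : (fun z => rdot ((u z)%:C%C *: (c *: f + g) z) e) =
      (fun z => complex.Re c * rdot ((u z)%:C%C *: f z) e
        - complex.Im c * rdot ((u z)%:C%C *: f z) ('i%C *: e)
        + rdot ((u z)%:C%C *: g z) e).
      apply/funext => z; rewrite -rlin scalerA mulrC -scalerA -scalerDr//.
    split; first by apply: intg_add => //; apply: intg_sub; exact: intg_scale.
    rewrite RintegralD//; last by apply: intg_sub; exact: intg_scale.
    by rewrite RintegralB//; [rewrite !RintegralZl//|exact: intg_scale|exact: intg_scale].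
  rewrite [LHS](_ : _ = (v y)%:C%C *: (a (weak_integral (c *: f + g)) : H) -
    (c *: ((v y)%:C%C *: (a (weak_integral f) : H)) +
     (v y)%:C%C *: (a (weak_integral g) : H)))//.
  by rewrite E BH_lin// scalerDr !scalerA [c * _]mulrC subrr.
- by exists (opnorm a) => xi; exact: rank1_le.
Qed.

Lemma rank1_opnorm : opnorm (rank1 : L2 mu (normed H) -> L2 nu (normed H)) <= opnorm a.
Proof.
apply: opnorm_le => [|xi dxi xi1]; first exact: opnorm_ge0.
by rewrite (le_trans (rank1_le dxi))// -[leRHS]mulr1 ler_wpM2l// opnorm_ge0.
Qed.

Lemma sqint_prod : sqint (nu \x mu)%E (fun z : Y * X => v z.1 * u z.2).
Proof.
have [mv v1] := hv; have [mu' u1] := hu.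
have mm : measurable_fun setT (fun z : Y * X => v z.1 * u z.2).
  apply: measurable_funM.
    exact: (measurableT_comp mv measurable_fst).
  exact: (measurableT_comp mu' measurable_snd).
apply: sqintP => //.
rewrite fubini_tonelli1//; last 2 first.
- by apply/measurable_EFinP; exact: measurable_funX.
- by move=> z; rewrite lee_fin sqr_ge0.
rewrite /fubini_F (_ : (fun y => _) = (fun y => (v y ^+ 2)%:E)); first by rewrite v1 ltry.
apply/funext => y /=.
transitivity (\int[mu]_x ((v y ^+ 2)%:E * (u x ^+ 2)%:E))%E.
  by apply: eq_integral => x _; rewrite -EFinM exprMn.
rewrite ge0_integralZl//; first by rewrite u1 mule1.
- by apply/measurable_EFinP; exact: measurable_funX.
- by move=> x _; rewrite lee_fin sqr_ge0.
- by rewrite lee_fin sqr_ge0.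
Qed.

Lemma rank1_L2_kernel : L2_kernel mu nu A rank1_kernel.
Proof.
have h := @L2_scale _ _ _ (nu \x mu)%E (Defs.subspace A) (fun z => v z.1 * u z.2) a.
apply: h => [r w [dw Aw]||]; last by split.
- split; last exact: opnormZ.
  by split; [exact: dom_BH_Z | have [_ [_ _ h] _ _ _] := hA; exact: h].
- exact: sqint_prod.
Qed.

Lemma rank1_kernel_op : kernel_op dot rank1_kernel rank1.
Proof.
split; first exact: rank1_dom.
move=> xi dxi; apply: aeW => y; apply/is_integral_HP => e.
(* The adjoint [b] of [a] carries [a] across the weak integral: the kernel tested against [e] is
   [u xi] tested against [b e]. *)
have [_ _ _ adj _] := hA; have [b Ab bE] := adj a Aa.
have /is_integral_HP /(_ (b e)) [i1 E] := weak_integralP dxi.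
have zE z : rdot (rank1_kernel (y, z) (xi z)) e = v y * rdot ((u z)%:C%C *: xi z) (b e).
  rewrite /rank1_kernel /=.
  rewrite [X in rdot X _](_ : _ = (v y * u z)%:C%C *: a (xi z))//.
  by rewrite !rdotZl mulrA /real_dot bE.
split.
  rewrite (_ : _ \o _ = EFin \o (fun z => v y * rdot ((u z)%:C%C *: xi z) (b e))).
    exact: intg_scale.
  by apply/funext => z /=; rewrite -zE.
rewrite /rank1 rdotZl [X in _ * X](_ : _ = rdot (weak_integral xi) (b e)).
  rewrite E -RintegralZl//; apply: eq_Rintegral => z _; exact/esym/zE.
by rewrite /real_dot bE.
Qed.

Definition rank1_scalar (f : X -> R[i]) : L2 nu (scalars R) :=
  fun y => (v y)%:C%C *: (pair_scalar mu u f : scalars R).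

Lemma rank1_scalar_nrm (c : R[i]) :
  nrm (L2 nu (scalars R)) (fun y => (v y)%:C%C *: (c : scalars R)) = N c.
Proof.
rewrite (nrm_L2_scale (@homogeneous_scalars R) hv)//=.
by rewrite ger0_norm// Re_normC_ge0.
Qed.

(** The image is spanned by [v], so compactness reduces to the Bolzano-Weierstrass theorem for the
    coefficients [pair_scalar]. The bound [2] adds the estimates of the real and imaginary parts. *)
Lemma rank1_scalar_compact : @compact_op R (L2 mu (scalars R)) (L2 nu (scalars R)) rank1_scalar.
Proof.
split; first split.
- move=> f df; apply: (L2_scale (@homogeneous_scalars R)) => //; exact: unit_sqint.
- move=> c f g df dg; apply: L2_nrm0 => y.
  rewrite (_ : _ y = 0); first exact: (@Re_norm0 R (R[i]^o)).
  rewrite [LHS](_ : _ = (v y)%:C%C * pair_scalar mu u (fun z => c * f z + g z)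
    - (c * ((v y)%:C%C * pair_scalar mu u f) + (v y)%:C%C * pair_scalar mu u g))//.
  by rewrite pair_scalar_lin//; ring.
- exists 2 => f df; rewrite rank1_scalar_nrm (le_trans (Re_normC_le _))//.
  by have [] := pair_scalar_le hu df => h1 h2; rewrite mulr_natl mulr2n lerD.
move=> f hf.
have [n|s [hs [c hc]]] := @bolzano_weierstrass_C R (fun n => pair_scalar mu u (f n)).
  have [dfn fn1] := hf n; have [h1 h2] := pair_scalar_le hu dfn.
  by split; [exact: le_trans h1 fn1|exact: le_trans h2 fn1].
exists s; split=> //; exists (fun y => (v y)%:C%C *: (c : scalars R)).
  by apply: (L2_scale (@homogeneous_scalars R)) => //; exact: unit_sqint.
rewrite (_ : (fun n => nrm _ _) = fun n => complex.Re `|pair_scalar mu u (f (s n)) - c|)//.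
apply/funext => n; rewrite -rank1_scalar_nrm; congr (nrm _ _); apply/funext => y.
by rewrite scalerBr.
Qed.

(** The operator is itself an elementary tensor, of [rank1_scalar] and [a], so it serves as its own
    approximation in the norm closure. The identity behind this is that [f h] has weak integral
    [pair_scalar f] times [h]. *)
Lemma rank1_compact_tensor : dom (Defs.subspace (@compact_tensor R H dX dY X Y mu nu A)) rank1.
Proof.
have d1 := rank1_dom; split=> //; split=> // e e0.
exists rank1; last first.
  rewrite subrr; apply: le_lt_trans e0; apply: opnorm_le => // f df _.
  by rewrite L2_nrm0// => y; exact: (@Re_norm0 R H).
exists 1%N, (fun=> rank1); split; last by rewrite big_ord1.
move=> i; exists rank1_scalar, a; split=> //; first exact: rank1_scalar_compact.
split=> // f h df; apply: L2_nrm0 => y.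
rewrite (_ : _ y = 0); first exact: Re_norm0.
have E : weak_integral (fun x => f x *: h) = pair_scalar mu u f *: h.
  apply: weak_integralE; apply/is_integral_HP => e'.
  have i1 := integrable_scalar_Re hu df; have i2 := integrable_scalar_Im hu df.
  have zE z : rdot ((u z)%:C%C *: (f z *: h)) e' =
     complex.Re (dot h e') * (u z * complex.Re (f z))
      - complex.Im (dot h e') * (u z * complex.Im (f z)).
    by rewrite rdotZl /real_dot linearZl_LR /= ReM; ring.
  have fE : (fun z => rdot ((u z)%:C%C *: (f z *: h)) e') = (fun z =>
     complex.Re (dot h e') * (u z * complex.Re (f z))
      - complex.Im (dot h e') * (u z * complex.Im (f z))) by apply/funext.
  rewrite fE; split; first by apply: intg_sub; exact: intg_scale.
  rewrite RintegralB//; [|exact: intg_scale|exact: intg_scale].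
  rewrite !RintegralZl// pair_scalarE /real_dot linearZl_LR /= ReM /=.
  by rewrite mulrC; congr (_ - _); rewrite mulrC.
rewrite [LHS](_ : _ = (v y)%:C%C *: a (weak_integral (fun x => f x *: h)) -
  ((v y)%:C%C * pair_scalar mu u f) *: a h)//.
by rewrite E BH_Z// scalerA subrr.
Qed.

End rank_one.

(** * Multipliers on rank one kernels *)

Section bounded_maps.
Variables (R : realType) (H : completeNormedModType R[i]).
Local Notation N x := (complex.Re `|x|).

Let addZ_cancel (c : R[i]) (x y x' y' : H) :
  (c *: x + y) + (c *: x' + y') - (c *: (x + x') + (y + y')) = 0.
Proof. by rewrite scalerDr addrACA subrr. Qed.

Lemma dom_BH_D (a b : BH H) : dom (BH H) a -> dom (BH H) b -> dom (BH H) (a + b).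
Proof.
move=> da db; split=> //.
- move=> c u v _ _.
  rewrite [X in nrm _ X](_ : _ = 0 :> H); first exact: (@Re_norm0 R H).
  rewrite [LHS](_ : _ = (a (c *: u + v) + b (c *: u + v)) -
    (c *: (a u + b u) + (a v + b v)) :> H)//.
  rewrite (BH_lin c u v da) (BH_lin c u v db); exact: addZ_cancel.
- exists (opnorm a + opnorm b) => v _ /=.
  by rewrite mulrDl (le_trans (Re_normD _ _))// lerD// BH_le.
Qed.

Lemma BH_eq0 (a : BH H) : dom (BH H) a -> opnorm a = 0 -> a = 0.
Proof.
move=> da a0; apply/funext => x; apply: Re_norm_eq0; apply/eqP; rewrite eq_le Re_norm_ge0 andbT.
by have := BH_le x da; rewrite a0 mul0r.
Qed.

Variables (A : set (BH H)) (f : BH H -> BH H).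
Hypothesis sA : A `<=` dom (BH H).
Hypothesis fb : @bounded_op R (Defs.subspace A) (BH H) f.

Lemma map_dom a : A a -> dom (BH H) (f a).
Proof. by move=> Aa; have [h _ _] := fb; apply: h; split=> //; exact: sA. Qed.

Lemma map_lin c a b : A a -> A b -> A (c *: a + b) ->
  f (c *: a + b) = c *: f a + f b.
Proof.
move=> Aa Ab Ac; have [_ h _] := fb; apply/eqP; rewrite -subr_eq0; apply/eqP.
have := h c a b (conj (sA Aa) Aa) (conj (sA Ab) Ab).
apply: BH_eq0; rewrite -scaleN1r; apply: dom_BH_D; first exact: map_dom.
apply: dom_BH_Z; apply: dom_BH_D; last exact: map_dom.
by apply: dom_BH_Z; exact: map_dom.
Qed.

(** This is the case of one by one matrices; [p1] identifies the norm of such a matrix with that of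
    its entry. *)
Lemma cb_norm_le_opnorm c : cb_norm_le A f c ->
  forall a, A a -> opnorm (f a) <= c * opnorm a.
Proof.
have p1 (T : BH H) : @opnorm R (power 1 (normed H)) (power 1 (normed H))
    (matrix_op (fun _ _ : 'I_1 => T)) = opnorm T.
  have s1 (v : 'I_1 -> H) : Num.sqrt (\sum_i N (v i) ^+ 2) = N (v ord0).
    by rewrite big_ord1 sqrtr_sqr ger0_norm// Re_norm_ge0.
  rewrite /opnorm; congr sup; apply/seteqP; split.
    move=> _ [v [dv v1] <-]; exists (v ord0) => /=.
      by split=> //; rewrite -s1.
    by rewrite s1 /matrix_op big_ord1.
  move=> _ [v [dv v1] <-]; exists (fun=> v) => /=.
    by split=> //; rewrite s1.
  by rewrite s1 /matrix_op big_ord1.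
move=> h a Aa; have := h 1%N (fun _ _ => a) (fun _ _ => Aa).
by rewrite !p1.
Qed.

End bounded_maps.

Section fubini_real.
Context d1 d2 (T1 : measurableType d1) (T2 : measurableType d2) (R : realType).
Variables (m1 : {sigma_finite_measure set T1 -> \bar R}).
Variables (m2 : {sigma_finite_measure set T2 -> \bar R}).
Variable f : T1 * T2 -> R.
Hypothesis imf : (m1 \x m2)%E.-integrable setT (EFin \o f).

(** With every section integrable, the inner extended integral is finite everywhere, so taking real
    values loses nothing and the extended Fubini theorem transfers. *)
Lemma fubiniR1 : (forall x, m2.-integrable setT (EFin \o (fun y => f (x, y)))) ->
  m1.-integrable setT (EFin \o (fun x => \int[m2]_y f (x, y))) /\
  \int[m1]_x \int[m2]_y f (x, y) = \int[(m1 \x m2)%E]_z f z.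
Proof.
move=> hf; have E : EFin \o (fun x => \int[m2]_y f (x, y)) = fubini_F m2 (EFin \o f).
  apply/funext => x /=; rewrite /Rintegral fineK//.
  by apply: integrable_fin_num => //; exact: hf.
split; first by rewrite E; exact: integrable_fubini_F.
rewrite /Rintegral -integral12_prod_meas1//; congr fine.
by rewrite -E.
Qed.

Lemma fubiniR2 : (forall y, m1.-integrable setT (EFin \o (fun x => f (x, y)))) ->
  m2.-integrable setT (EFin \o (fun y => \int[m1]_x f (x, y))) /\
  \int[m2]_y \int[m1]_x f (x, y) = \int[(m1 \x m2)%E]_z f z.
Proof.
move=> hf; have E : EFin \o (fun y => \int[m1]_x f (x, y)) = fubini_G m1 (EFin \o f).
  apply/funext => y /=; rewrite /Rintegral fineK//.
  by apply: integrable_fin_num => //; exact: hf.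
split.
  have mf := measurable_int _ imf.
  rewrite E; apply/integrableP; split; first exact: (measurable_fubini_G imf).
  have h := (integrable21ltyP m1 m2 mf).1 imf; apply: le_lt_trans h.
  apply: ge0_le_integral => //.
  - by apply: measurableT_comp => //; exact: (measurable_fubini_G imf).
  - apply: (measurable_fun_fubini_tonelli_G (abse \o (EFin \o f))) => [|z].
      exact: measurableT_comp.
    exact: abse_ge0.
  - by move=> y _; apply: le_abse_integral => //; exact: (measurable_int _ (hf y)).
rewrite /Rintegral -integral21_prod_meas1//; congr fine.
by rewrite -E.
Qed.

End fubini_real.

Lemma Rintegral0 d (Z : measurableType d) (R : realType) (m : {measure set Z -> \bar R})
  (f : Z -> R) : (forall z, f z = 0) -> \int[m]_z f z = 0.
Proof.
by move=> f0; rewrite (_ : f = cst 0) ?/Rintegral ?integral0//; apply/funext.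
Qed.

Section operators_L2.
Variables (R : realType) (dX dY : measure_display).
Variables (X : measurableType dX) (Y : measurableType dY).
Variables (mu : {sigma_finite_measure set X -> \bar R}).
Variables (nu : {sigma_finite_measure set Y -> \bar R}).
Variables (H : completeNormedModType R[i]) (dot : {dot H for (@Num.conj R[i])}).
Hypothesis hd : norm_from_dot dot.
Hypothesis sepH : separable_space H.
Local Notation N x := (complex.Re `|x|).
Local Notation rdot := (real_dot dot).
Local Notation L2X := (L2 mu (normed H)).
Local Notation L2Y := (L2 nu (normed H)).

Lemma ops_bound (T : ops H mu nu) : dom (ops H mu nu) T ->
  exists c, forall xi, dom L2X xi -> nrm L2X xi <= 1 -> nrm L2Y (T xi) <= c.
Proof.
move=> [_ _ [c hc]]; exists `|c| => xi dxi xi1.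
apply: le_trans (hc xi dxi) _; apply: le_trans (ler_norm _) _.
rewrite normrM -[leRHS]mulr1 ler_wpM2l// ger0_norm//.
exact: sqrtr_ge0.
Qed.

(** The left side is one of the values whose supremum is [opnorm (S - T)]. That this supremum is
    over a bounded set follows from the bounds of [S] and [T] through [(p + q)^2 <= 2 p^2 + 2 q^2],
    without Minkowski's inequality. *)
Lemma ops_dist (S T : ops H mu nu) xi :
  dom (ops H mu nu) S -> dom (ops H mu nu) T -> dom L2X xi -> nrm L2X xi <= 1 ->
  Num.sqrt (\int[nu]_y (N (S xi y - T xi y) ^+ 2)) <= opnorm (S - T : ops H mu nu).
Proof.
move=> dS dT dxi xi1.
have [c hc] := ops_bound dS; have [c' hc'] := ops_bound dT.
apply: (@opnorm_ge R L2X L2Y _ (Num.sqrt (2 * c ^+ 2 + 2 * c' ^+ 2)) xi) => // f df f1.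
have dSf : dom L2Y (S f) by have [h _ _] := dS; exact: h.
have dTf : dom L2Y (T f) by have [h _ _] := dT; exact: h.
have sb := sqint_L2_dist sepH dSf dTf.
have sS := sqint_L2_norm dSf; have sT := sqint_L2_norm dTf.
have nS : \int[nu]_y (N (S f y) ^+ 2) <= c ^+ 2.
  have h := hc f df f1; rewrite -[leLHS]sqr_sqrtr ?ler_sqr ?nnegrE ?sqrtr_ge0//.
  - by apply: le_trans h; exact: sqrtr_ge0.
  - by apply: Rintegral_ge0 => y _; exact: sqr_ge0.
have nT : \int[nu]_y (N (T f y) ^+ 2) <= c' ^+ 2.
  have h := hc' f df f1; rewrite -[leLHS]sqr_sqrtr ?ler_sqr ?nnegrE ?sqrtr_ge0//.
  - by apply: le_trans h; exact: sqrtr_ge0.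
  - by apply: Rintegral_ge0 => y _; exact: sqr_ge0.
apply: ler_wsqrtr.
apply: (@le_trans _ _ (\int[nu]_y (2 * N (S f y) ^+ 2 + 2 * N (T f y) ^+ 2))).
  apply: le_Rintegral_setT; [exact: sb.2| |].
    by apply: intg_add; apply: intg_scale; [exact: sS.2|exact: sT.2].
  move=> y; have h : N (S f y - T f y) <= N (S f y) + N (T f y).
    by rewrite (le_trans (Re_normD _ _))// normrN.
  apply: (@le_trans _ _ ((N (S f y) + N (T f y)) ^+ 2)).
    by rewrite ler_sqr ?nnegrE ?addr_ge0 ?Re_norm_ge0.
  have := sqr_ge0 (N (S f y) - N (T f y)); nra.
rewrite RintegralD//; [|exact: intg_scale sS.2|exact: intg_scale sT.2].
rewrite !RintegralZl//; [|exact: sT.2|exact: sS.2].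
by rewrite lerD// ler_wpM2l.
Qed.

(** Convergence in operator norm thus passes to the pairings with [v g], uniformly in [xi] of norm
    at most one and in the unit function [v]. *)
Lemma pairing_dist (S T : ops H mu nu) xi v g :
  dom (ops H mu nu) S -> dom (ops H mu nu) T -> dom L2X xi -> nrm L2X xi <= 1 ->
  unit_fun nu v ->
  `|\int[nu]_y (v y * rdot (S xi y) g) - \int[nu]_y (v y * rdot (T xi y) g)|
   <= N g * opnorm (S - T : ops H mu nu).
Proof.
move=> dS dT dxi xi1 hv.
have dSf : dom L2Y (S xi) by have [h _ _] := dS; exact: h.
have dTf : dom L2Y (T xi) by have [h _ _] := dT; exact: h.
have sS := sqint_L2_dot hd g dSf; have sT := sqint_L2_dot hd g dTf.
have su := unit_sqint hv.
rewrite -RintegralB//; [|exact: sqint_mul|exact: sqint_mul].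
apply: le_trans (ler_wpM2l (Re_norm_ge0 g) (ops_dist dS dT dxi xi1)).
rewrite (_ : (fun y => _) = (fun y => v y * (rdot (S xi y) g - rdot (T xi y) g))); last first.
  by apply/funext => y; rewrite mulrBr.
apply: unit_CS_le => //; last exact: sqint_L2_dist.
- by apply: measurable_funB; [case: sS | case: sT].
- exact: Re_norm_ge0.
- by move=> y; rewrite -rdotBl mulrC real_dot_CauchySchwarz.
Qed.

End operators_L2.

Section multiplier.
Variables (R : realType) (dX dY : measure_display).
Variables (X : measurableType dX) (Y : measurableType dY).
Variables (mu : {sigma_finite_measure set X -> \bar R}).
Variables (nu : {sigma_finite_measure set Y -> \bar R}).
Variables (H : completeNormedModType R[i]) (dot : {dot H for (@Num.conj R[i])}).
Hypothesis hd : norm_from_dot dot.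
Hypothesis sepH : separable_space H.
Variables (A : set (BH H)) (phi : X * Y -> BH H -> BH H).
Hypothesis hA : Cstar_subalgebra dot A.
Hypothesis hphi : compact_Schur_multiplier dot mu nu A phi.
Local Notation N x := (complex.Re `|x|).
Local Notation rdot := (real_dot dot).
Local Notation L2X := (L2 mu (normed H)).
Local Notation L2Y := (L2 nu (normed H)).

Let sA : A `<=` dom (BH H). Proof. by case: hA. Qed.
Let A0 : A 0. Proof. by have [_ [h _ _] _ _ _] := hA. Qed.
Let AZ c a : A a -> A (c *: a).
Proof. by have [_ [_ _ h] _ _ _] := hA; exact: h. Qed.
Let AD a b : A a -> A b -> A (a + b).
Proof. by have [_ [_ h _] _ _ _] := hA; exact: h. Qed.

Lemma phi_bounded z : @bounded_op R (Defs.subspace A) (BH H) (phi z).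
Proof. by have [[h _ _ _] _] := hphi; have [] := h z. Qed.

Lemma phi_dom z a : A a -> dom (BH H) (phi z a).
Proof. exact: map_dom sA (phi_bounded z) a. Qed.

Lemma phi_lin z c a b : A a -> A b -> phi z (c *: a + b) = c *: phi z a + phi z b.
Proof.
move=> Aa Ab; apply: (map_lin sA (phi_bounded z)) => //.
by apply: AD => //; exact: AZ.
Qed.

Lemma phiZ z c a : A a -> phi z (c *: a) = c *: phi z a.
Proof.
have phi0 : phi z 0 = 0.
  have := phi_lin z 1 A0 A0; rewrite !scale1r addr0 => /eqP.
  by rewrite -subr_eq subrr => /eqP.
by move=> Aa; have := phi_lin z c Aa A0; rewrite phi0 !addr0.
Qed.

Lemma phi_le : exists c, forall z a, A a -> opnorm (phi z a) <= c * opnorm a.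
Proof.
have [[_ [c hc] _ _] _] := hphi; exists c => z a Aa.
exact: (cb_norm_le_opnorm (hc z)).
Qed.

Variables (a : BH H) (h g : H).
Hypothesis Aa : A a.

(** The function called [b] in the overview. *)
Definition coef (z : X * Y) : R := rdot (phi z a h) g.

Lemma coef_meas : measurable_fun setT coef.
Proof. by have [[_ _ hm _] _] := hphi; have [] := hm a Aa h g. Qed.

Lemma coef_le : exists c, forall z, `|coef z| <= c.
Proof.
have [c hc] := phi_le; exists (c * opnorm a * N h * N g) => z.
rewrite (le_trans (real_dot_CauchySchwarz hd _ _))// ler_wpM2r ?Re_norm_ge0//.
rewrite (le_trans (BH_le _ (phi_dom z Aa)))// ler_wpM2r ?Re_norm_ge0//.
exact: hc.
Qed.

Lemma coef_integrable u v : unit_fun mu u -> unit_fun nu v ->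
  (mu \x nu)%E.-integrable setT (EFin \o (fun z => (u z.1 ^+ 2 * v z.2 ^+ 2) * coef z)).
Proof.
move=> hu hv; have [c hc] := coef_le.
have [m1 i1] := sqint_prod hv hu.
apply: (le_intg _ _ (intg_scale `|c| i1)).
  apply: measurable_funM; last exact: coef_meas.
  by have := measurable_funX 2 m1; congr measurable_fun; apply/funext => z; rewrite exprMn.
move=> z; rewrite -exprMn [u _ * _]mulrC normrM [leLHS]mulrC [X in _ * X]ger0_norm ?sqr_ge0//.
rewrite ler_wpM2r ?sqr_ge0//.
by rewrite (le_trans (hc z))// ler_norm.
Qed.

Lemma coef_integrable_x u y : unit_fun mu u ->
  mu.-integrable setT (EFin \o (fun x => u x ^+ 2 * coef (x, y))).
Proof.
move=> hu; have [c hc] := coef_le; have [mu' i1] := unit_sqint hu.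
apply: (le_intg _ _ (intg_scale `|c| i1)).
  apply: measurable_funM; first exact: measurable_funX.
  exact: (measurableT_comp coef_meas).
move=> x; rewrite normrM [leLHS]mulrC [X in _ * X]ger0_norm ?sqr_ge0// ler_wpM2r ?sqr_ge0//.
by rewrite (le_trans (hc _))// ler_norm.
Qed.

Hypothesis a1 : opnorm a <= 1.
Hypothesis h1 : N h <= 1.
Variables (u_ : nat -> X -> R) (v_ : nat -> Y -> R).
Hypothesis hu : forall n, unit_fun mu (u_ n).
Hypothesis hv : forall n, unit_fun nu (v_ n).
Hypothesis disj : forall m n x y, m != n -> u_ m x * u_ n x * (v_ m y * v_ n y) = 0.

Let T n : ops H mu nu := @rank1 R dX dY X Y mu nu H dot (u_ n) (v_ n) a.
Let xi n : X -> H := fun x => (u_ n x)%:C%C *: h.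

Let dxi n : dom L2X (xi n).
Proof. by apply: L2_scale; [exact: homogeneous_normed|exact: unit_sqint|]. Qed.

Let xi1 n : nrm L2X (xi n) <= 1.
Proof.
rewrite (nrm_L2_scale (@homogeneous_normed R H) (hu n))//.
by rewrite ger0_norm//; exact: Re_norm_ge0.
Qed.

(** Here [P m n] pairs the image of [T m] with the [n]-th test vectors and [J n] does so for the
    limit [w]. For large [m] the numbers [P (s m) n] are within [e / 2] of [J n], uniformly in [n].
    Taking [n = s (M + 1)], the entry [P (s M) n] is off the diagonal and vanishes, so [J n] is
    small, and hence so is [P n n]. *)
Lemma diagonal_small e : 0 < e -> exists n,
  `|\int[(mu \x nu)%E]_z ((u_ n z.1 ^+ 2 * v_ n z.2 ^+ 2) * coef z)| <= e.
Proof.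
move=> e0; have [_ [F [SF _ [[Fdom _ _] Fc]]]] := hphi.
have dT n : dom (Defs.subspace (@compact_tensor R H dX dY X Y mu nu A)) (T n).
  exact: (rank1_compact_tensor hd hA (hu n) (hv n) Aa).
have [n|s [hs [w dw]]] := Fc T.
  split=> //; apply: le_trans a1.
  exact: (rank1_opnorm hd hA (hu n) (hv n) Aa).
move=> /cvgrPdist_lt wlim.
pose P m n := \int[nu]_y (v_ n y * rdot (F (T m) (xi n) y) g).
pose J n := \int[nu]_y (v_ n y * rdot (w (xi n) y) g).
have Plim : exists M, forall m n, (M <= m)%N -> `|P (s m) n - J n| <= e / 2.
  have [|M _ hM] := wlim (e / 2 / (N g + 1)).
    by rewrite !divr_gt0// ltr_wpDl ?Re_norm_ge0.
  exists M => m n Mm; apply: le_trans (pairing_dist hd sepH _ (Fdom _ (dT _)) dw (dxi n) (xi1 n) (hv n)) _.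
  have := hM m Mm; rewrite /= sub0r normrN => /(le_lt_trans (ler_norm _)) /ltW lt.
  have g0 := Re_norm_ge0 g; have g1 : 0 < N g + 1 by rewrite ltr_wpDl.
  apply: (@le_trans _ _ (N g * (e / 2 / (N g + 1)))); first by rewrite ler_wpM2l.
  rewrite mulrCA ler_piMr//; first by rewrite divr_ge0// ltW.
  by rewrite ler_pdivrMr// mul1r lerDl.
(* By homogeneity of [phi (x, y)], the image of [T m] has kernel [v_m(y) u_m(x) phi(x, y)(a)]; a
   kernel determines its operator only for almost every [y]. *)
have Pae m n : {ae nu, forall y, rdot (F (T m) (xi n) y) g =
    \int[mu]_x (v_ m y * (u_ m x * u_ n x) * coef (x, y))}.
  have [_ Fk] := SF _ _ (rank1_L2_kernel hA (hu m) (hv m) Aa)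
    (rank1_kernel_op hd hA (hu m) (hv m) Aa).
  apply: filterS (Fk _ (dxi n)) => y /is_integral_HP /(_ g) [_ ->].
  apply: eq_Rintegral => x _; rewrite /schur_mul /rank1_kernel /= phiZ//.
  rewrite [X in rdot X _](_ : _ = (v_ m y * u_ m x)%:C%C *: (phi (x, y) a (xi n x) : H))//.
  by rewrite /xi BH_Z ?rdotZl; [rewrite /coef; ring|exact: phi_dom].
have Poff m n : m != n -> P m n = 0.
  move=> mn; rewrite /P /Rintegral (ae_eq_integral (cst 0%E)) ?integral0//.
    apply/measurable_EFinP; apply: measurable_funM; first by case: (hv n).
    have [h' _ _] := Fdom _ (dT m).
    by have [] := sqint_L2_dot hd g (h' _ (dxi n)).
  apply: filterS (Pae m n) => y -> _ /=; congr EFin.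
  have [v0|v0] := eqVneq (v_ n y) 0; first by rewrite v0 mul0r.
  rewrite Rintegral0 ?mulr0// => x.
  have /eqP := disj x y mn; rewrite !mulf_eq0 (negPf v0) orbF.
  by move=> /orP[/orP[]|] /eqP ->; rewrite ?mul0r ?mulr0 ?mul0r.
have Pdiag n : P n n =
   \int[(mu \x nu)%E]_z ((u_ n z.1 ^+ 2 * v_ n z.2 ^+ 2) * coef z).
  have i1 y : mu.-integrable setT (EFin \o
      (fun x => u_ n x ^+ 2 * v_ n y ^+ 2 * coef (x, y))).
    have := intg_scale (v_ n y ^+ 2) (coef_integrable_x y (hu n)).
    by congr (mu.-integrable setT _); apply/funext => x /=; congr EFin; ring.
  have [i2 <-] := fubiniR2 (coef_integrable (hu n) (hv n)) i1.
  rewrite /P /Rintegral; congr fine; apply: ae_eq_integral => //.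
  - apply/measurable_EFinP; apply: measurable_funM; first by case: (hv n).
    have [h' _ _] := Fdom _ (dT n).
    by have [] := sqint_L2_dot hd g (h' _ (dxi n)).
  - exact: (measurable_int _ i2).
  - apply: filterS (Pae n n) => y -> _ /=; congr EFin.
    have E (r : R) : \int[mu]_x (r * (u_ n x ^+ 2 * coef (x, y))) =
        r * \int[mu]_x (u_ n x ^+ 2 * coef (x, y)).
      by rewrite RintegralZl//; exact: coef_integrable_x.
    transitivity (v_ n y * (\int[mu]_x (v_ n y * (u_ n x ^+ 2 * coef (x, y))))).
      by congr (_ * _); apply: eq_Rintegral => x _; ring.
    rewrite E mulrA -E; apply: eq_Rintegral => x _; ring.
have [M hM] := Plim.
have sM : (s M != s M.+1)%N by rewrite neq_ltn hs.
exists (s M.+1); rewrite -Pdiag.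
have := hM M (s M.+1) (leqnn _); have := hM M.+1 (s M.+1) (leqnSn _).
rewrite (Poff _ _ sM) sub0r normrN => q2 q1.
rewrite -[P _ _](subrK (J (s M.+1))) (le_trans (ler_normD _ _))//.
by rewrite [leRHS]splitr lerD.
Qed.

End multiplier.

(** * Non-atomic measures and integrals over rectangles *)

Section indicators.
Context d (Z : measurableType d) (R : realType) (m : {measure set Z -> \bar R}).
Implicit Types (f g : Z -> R) (E : set Z).
Local Notation intg f := (m.-integrable setT (EFin \o f)).

Lemma indic_norm_le E f z : `|\1_E z * f z| <= `|f z|.
Proof.
rewrite indicE; case: (z \in E); first by rewrite mul1r.
by rewrite mul0r normr0.
Qed.

Lemma indic_intg E : measurable E -> (m E < +oo)%E ->
  intg (\1_E : Z -> R) /\ \int[m]_z (\1_E z : R) = fine (m E).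
Proof.
move=> mE Eoo; have E1 : (\int[m]_z (\1_E z : R)%:E = m E)%E.
  by rewrite integral_indic// setIT.
split; last by rewrite /Rintegral E1.
apply/integrableP; split; first exact/measurable_EFinP.
rewrite (eq_integral (fun z => (\1_E z : R)%:E)) ?E1// => z _.
by rewrite gee0_abs// lee_fin.
Qed.

Lemma intg_indicM E f : measurable E -> intg f -> intg (fun z => \1_E z * f z).
Proof.
move=> mE hf; have /measurable_EFinP mf := measurable_int _ hf.
apply: (le_integrable _ _ _ hf) => //.
  by apply/measurable_EFinP; apply: measurable_funM => //; exact: measurable_indic.
by move=> z _ /=; rewrite lee_fin indic_norm_le.
Qed.

Lemma integral_indicM E f : measurable E -> intg f ->
  (\int[m]_(z in E) (f z)%:E = (\int[m]_z (\1_E z * f z))%:E)%E.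
Proof.
move=> mE hf; rewrite /Rintegral fineK; last first.
  by apply: integrable_fin_num => //; exact: intg_indicM.
rewrite integral_mkcond; apply: eq_integral => z _.
rewrite patchE indicE; case: (z \in E); by rewrite ?mul1r ?mul0r.
Qed.

Lemma bounded_indicM_intg E f c : measurable E -> (m E < +oo)%E ->
  measurable_fun setT f -> (forall z, `|f z| <= c) -> intg (fun z => \1_E z * f z).
Proof.
move=> mE Eoo mf fc; have [i1 _] := indic_intg mE Eoo.
apply: (le_intg _ _ (intg_scale `|c| i1)).
  by apply: measurable_funM => //; exact: measurable_indic.
move=> z; rewrite indicE; case: (z \in E).
  by rewrite mul1r mulr1 (le_trans (fc z))// ler_norm.
by rewrite mul0r normr0 mulr0.
Qed.

Lemma unit_indic E : measurable E -> (0 < m E)%E -> (m E < +oo)%E ->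
  unit_fun m (fun z => (Num.sqrt (fine (m E)))^-1 * \1_E z).
Proof.
move=> mE E0 Eoo; split; first by apply: measurable_funM => //; exact: measurable_indic.
have fE : 0 < fine (m E) by rewrite fine_gt0// E0.
have -> : (fun z => (((Num.sqrt (fine (m E)))^-1 * \1_E z) ^+ 2)%:E) =
    (fun z => ((fine (m E))^-1)%:E * (\1_E z : R)%:E)%E.
  apply/funext => z; rewrite -EFinM exprMn exprVn sqr_sqrtr ?ltW//.
  by rewrite indicE; case: (z \in E); rewrite ?expr1n ?expr0n.
rewrite integralZl//; last by have [] := indic_intg mE Eoo.
rewrite integral_indic// setIT -[X in (_ * X)%E]fineK ?ge0_fin_numE//.
by rewrite -EFinM mulVf// gt_eqF.
Qed.

(** Iterating non-atomicity from [G] gives decreasing sets [D n], each losing positive measure to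
    the next. The successive differences are the required disjoint sets. *)
Lemma nonatomic_split (G : set Z) : nonatomic m -> measurable G ->
  (0 < m G)%E -> (m G < +oo)%E ->
  exists E : nat -> set Z, [/\ forall n, measurable (E n), forall n, E n `<=` G,
    forall n, (0 < m (E n))%E & forall i j, i != j -> E i `&` E j = set0].
Proof.
move=> na mG G0 Goo.
pose good A := [/\ measurable A, A `<=` G & (0 < m A)%E].
have /choice [st stP] A : exists B, good A ->
    [/\ good B, B `<=` A & (0 < m (A `\` B))%E].
  have [[mA AG A0]|nA] := pselect (good A); last by exists set0.
  have [B [mB BA B0 BltA]] := na A mA A0.
  exists B => _; split=> //; first by split=> //; exact: subset_trans BA AG.
  (* Finiteness is what turns [m B < m A] into positive measure of the difference. *)
  have Aoo : (m A < +oo)%E by apply: le_lt_trans Goo; apply: le_measure; rewrite ?inE.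
  rewrite measureD// setIidr// sube_gt0//.
pose D n := iter n st G.
have gD n : good (D n).
  by elim: n => [|n IH]; [split | have [] := stP _ IH].
have sD i j : (i <= j)%N -> D j `<=` D i.
  elim: j => [|j IH]; first by rewrite leqn0 => /eqP ->.
  rewrite leq_eqVlt => /predU1P[->//|]; rewrite ltnS => /IH.
  by apply: subset_trans; have [] := stP _ (gD j).
exists (fun n => D n `\` D n.+1); split=> [n|n|n|i j].
- by apply: measurableD; [case: (gD n) | case: (gD n.+1)].
- by move=> z [Dz _]; have [_ h _] := gD n; exact: h.
- by have [] := stP _ (gD n).
- wlog ij : i j / (i < j)%N.
    move=> wl; rewrite neq_ltn => /orP[ij|ji]; first by apply: wl; rewrite // ltn_eqF.
    by rewrite setIC; apply: wl; rewrite // ltn_eqF.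
  move=> _; apply/seteqP; split=> // z [[_ nz] [zj _]].
  by apply: nz; exact: (sD i.+1 j ij).
Qed.

Lemma nonatomic_int_le0 (b : Z -> R) (E0 : set Z) : nonatomic m ->
  measurable E0 -> (m E0 < +oo)%E -> measurable_fun setT b ->
  intg (fun z => \1_E0 z * b z) ->
  (forall E : nat -> set Z, (forall n, measurable (E n)) -> (forall n, E n `<=` E0) ->
    (forall n, (0 < m (E n))%E) -> (forall i j, i != j -> E i `&` E j = set0) ->
    forall e, 0 < e -> exists n, `|\int[m]_z (\1_(E n) z * b z)| <= e * fine (m (E n))) ->
  \int[m]_z (\1_E0 z * b z) <= 0.
Proof.
move=> na mE0 E0oo mb ib hE; set c := (X in X <= 0).
rewrite leNgt; apply/negP => c0.
have M0 : 0 <= fine (m E0) by exact: fine_ge0.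
(* Chosen so that [e m(E0) < c]: were [G] null, [b] would be below [e] almost everywhere on [E0] and
   its integral could not reach [c]. *)
pose e := c / (fine (m E0) + 1).
have e0 : 0 < e by rewrite divr_gt0// ltr_wpDl.
pose G := E0 `&` [set z | e <= b z].
have mG : measurable G.
  apply: measurableI => //; rewrite -[X in measurable X]setTI.
  have -> : [set z | e <= b z] = b @^-1` `[e, +oo[.
    by apply/seteqP; split=> z /=; rewrite in_itv /= andbT.
  by apply: mb => //; exact: measurable_itv.
have sub_b E : measurable E -> E `<=` E0 -> intg (fun z => \1_E z * b z).
  move=> mE EE0; have := intg_indicM mE ib.
  congr (m.-integrable setT _); apply/funext => z /=; congr EFin.
  rewrite mulrA -[\1_E z * \1_E0 z]/((\1_E \* \1_E0) z) -indicI.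
  by rewrite (setIidl EE0).
have iG := sub_b G mG (@subIsetl _ _ _).
have [iE0 vE0] := indic_intg mE0 E0oo.
have Goo : (m G < +oo)%E.
  by apply: le_lt_trans E0oo; apply: le_measure; rewrite ?inE//; exact: subIsetl.
have G0 : (0 < m G)%E.
  rewrite lt_def measure_ge0 andbT; apply/negP => /eqP mG0.
  have vG : \int[m]_z (\1_G z * b z) = 0.
    rewrite /Rintegral (ae_eq_integral (cst 0%E)) ?integral0//.
      exact: (measurable_int _ iG).
    exists G; split=> // z /= h; apply: contrapT => nG; apply: h => _.
    by rewrite indicE memNset// mul0r.
  have : c <= \int[m]_z (e * \1_E0 z + \1_G z * b z).
    apply: le_Rintegral_setT => //; first by apply: intg_add => //; exact: intg_scale.
    move=> z; rewrite !indicE; have [zE|zE] := boolP (z \in E0); last first.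
      rewrite mul0r mulr0 add0r memNset ?mul0r// => -[zE' _].
      by move: zE; rewrite mem_set.
    rewrite mul1r mulr1; have [zG|zG] := boolP (z \in G).
      by rewrite mul1r lerDr ltW.
    rewrite mul0r addr0 leNgt; apply/negP => lt.
    move/negP: zG; apply; apply: mem_set; split; first exact: set_mem.
    exact: ltW.
  rewrite RintegralD//; last exact: intg_scale.
  rewrite RintegralZl// vE0 vG addr0 leNgt => /negP; apply.
  have M1 : 0 < fine (m E0) + 1 by rewrite ltr_wpDl.
  by rewrite /e mulrAC ltr_pdivrMr// ltr_pM2l// ltrDl.
have [E [mE EG E1 Ed]] := nonatomic_split na mG G0 Goo.
have EE0 n : E n `<=` E0 by apply: subset_trans (EG n) (@subIsetl _ _ _).
(* On subsets of [G] every average of [b] is at least [e], so the tolerance [e / 2] is already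
   contradictory. *)
have [n] := hE E mE EE0 E1 Ed (e / 2) ltac:(by rewrite divr_gt0).
have Eoo : (m (E n) < +oo)%E.
  by apply: le_lt_trans E0oo; apply: le_measure; rewrite ?inE.
have En0 : 0 < fine (m (E n)) by rewrite fine_gt0// E1.
have [iE vE] := indic_intg (mE n) Eoo.
apply/negP; rewrite -ltNge; apply: lt_le_trans (ler_norm _).
apply: (@lt_le_trans _ _ (e * fine (m (E n)))).
  by rewrite ltr_pM2r// ltr_pdivrMr// ltr_pMr// ltr1n.
rewrite -vE -RintegralZl//; apply: le_Rintegral_setT; [exact: intg_scale|exact: sub_b|].
move=> z; rewrite indicE; have [zE|zE] := boolP (z \in E n); last by rewrite mulr0 mul0r.
by rewrite mulr1 mul1r; have [] := EG n z (set_mem zE).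
Qed.

Lemma nonatomic_int_eq0 (b : Z -> R) (E0 : set Z) : nonatomic m ->
  measurable E0 -> (m E0 < +oo)%E -> measurable_fun setT b ->
  intg (fun z => \1_E0 z * b z) ->
  (forall E : nat -> set Z, (forall n, measurable (E n)) -> (forall n, E n `<=` E0) ->
    (forall n, (0 < m (E n))%E) -> (forall i j, i != j -> E i `&` E j = set0) ->
    forall e, 0 < e -> exists n, `|\int[m]_z (\1_(E n) z * b z)| <= e * fine (m (E n))) ->
  \int[m]_z (\1_E0 z * b z) = 0.
Proof.
move=> na mE0 E0oo mb ib hE; apply/eqP; rewrite eq_le nonatomic_int_le0//=.
have sub_b E : measurable E -> E `<=` E0 -> intg (fun z => \1_E z * b z).
  move=> mE EE0; have := intg_indicM mE ib.
  congr (m.-integrable setT _); apply/funext => z /=; congr EFin.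
  rewrite mulrA -[\1_E z * \1_E0 z]/((\1_E \* \1_E0) z) -indicI.
  by rewrite (setIidl EE0).
have opp E : measurable E -> E `<=` E0 ->
    \int[m]_z (\1_E z * - b z) = - \int[m]_z (\1_E z * b z).
  move=> mE EE0; rewrite -mulN1r -RintegralZl//; last exact: sub_b.
  by apply: eq_Rintegral => z _; ring.
rewrite -oppr_le0 -opp//; apply: nonatomic_int_le0 => //.
- exact: measurableT_comp.
- have := intg_scale (-1) ib; congr (m.-integrable setT _).
  by apply/funext => z /=; congr EFin; ring.
- move=> E mE EE0 E1 Ed e e0; have [n hn] := hE E mE EE0 E1 Ed e e0.
  by exists n; rewrite opp// normrN.
Qed.

End indicators.

Section rectangles.
Variables (R : realType) (dX dY : measure_display).
Variables (X : measurableType dX) (Y : measurableType dY).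
Variables (mu : {sigma_finite_measure set X -> \bar R}).
Variables (nu : {sigma_finite_measure set Y -> \bar R}).
Variables (b : X * Y -> R) (c : R).
Hypotheses (mb : measurable_fun setT b) (bc : forall z, `|b z| <= c).

Definition rect_int E F : R := \int[(mu \x nu)%E]_z (\1_E z.1 * \1_F z.2 * b z).

Lemma indicX (E : set X) (F : set Y) (z : X * Y) :
  (\1_(E `*` F) z : R) = \1_E z.1 * \1_F z.2.
Proof. by rewrite !indicE in_setX -natrM mulnb. Qed.

Lemma rect_finite (E : set X) (F : set Y) : measurable E -> measurable F ->
  (mu E < +oo)%E -> (nu F < +oo)%E -> ((mu \x nu)%E (E `*` F) < +oo)%E.
Proof.
move=> mE mF Eoo Foo; rewrite product_measure1E//.
by rewrite lte_mul_pinfty// ge0_fin_numE.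
Qed.

Lemma rect_intg E F : measurable E -> measurable F ->
  (mu E < +oo)%E -> (nu F < +oo)%E ->
  (mu \x nu)%E.-integrable setT (EFin \o (fun z => \1_E z.1 * \1_F z.2 * b z)).
Proof.
move=> mE mF Eoo Foo.
have := bounded_indicM_intg (measurableX mE mF) (rect_finite mE mF Eoo Foo) mb bc.
by congr integrable; apply/funext => z /=; rewrite indicX.
Qed.

Lemma rect_int_le E F : measurable E -> measurable F ->
  (mu E < +oo)%E -> (nu F < +oo)%E ->
  `|rect_int E F| <= c * (fine (mu E) * fine (nu F)).
Proof.
move=> mE mF Eoo Foo; have iI := rect_intg mE mF Eoo Foo.
have [i1 v1] := indic_intg (measurableX mE mF) (rect_finite mE mF Eoo Foo).
apply: le_trans (le_normr_Rintegral _ iI) _ => //.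
rewrite -fineM ?ge0_fin_numE// -product_measure1E// -v1 -RintegralZl//.
apply: le_Rintegral_setT; [exact: (integrable_norm iI)|exact: intg_scale|] => z /=.
rewrite -indicX indicE; case: (_ \in _); first by rewrite mul1r mulr1.
by rewrite mul0r normr0 mulr0.
Qed.

Let meas_x x : measurable_fun setT (fun y => b (x, y)).
Proof. exact: (measurableT_comp mb). Qed.

Let meas_y y : measurable_fun setT (fun x => b (x, y)).
Proof. exact: (measurableT_comp mb). Qed.

Lemma rect_int_x E F : measurable E -> measurable F ->
  (mu E < +oo)%E -> (nu F < +oo)%E ->
  mu.-integrable setT (EFin \o (fun x => \1_E x * \int[nu]_y (\1_F y * b (x, y)))) /\
  \int[mu]_x (\1_E x * \int[nu]_y (\1_F y * b (x, y))) = rect_int E F.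
Proof.
move=> mE mF Eoo Foo.
have sec x : nu.-integrable setT (EFin \o (fun y => \1_F y * b (x, y))).
  exact: (bounded_indicM_intg mF Foo (meas_x x) (fun y => bc (x, y))).
have := @fubiniR1 _ _ X Y R mu nu (fun z => \1_E z.1 * \1_F z.2 * b z) (rect_intg mE mF Eoo Foo).
have -> : (fun x => \1_E x * \int[nu]_y (\1_F y * b (x, y))) =
    (fun x => \int[nu]_y (\1_E x * \1_F y * b (x, y))).
  apply/funext => x; rewrite -RintegralZl//.
  by apply: eq_Rintegral => y _; rewrite mulrA.
apply=> x /=; have := intg_scale (\1_E x) (sec x).
by congr integrable; apply/funext => y /=; rewrite mulrA.
Qed.

Lemma rect_int_y E F : measurable E -> measurable F ->
  (mu E < +oo)%E -> (nu F < +oo)%E ->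
  nu.-integrable setT (EFin \o (fun y => \1_F y * \int[mu]_x (\1_E x * b (x, y)))) /\
  \int[nu]_y (\1_F y * \int[mu]_x (\1_E x * b (x, y))) = rect_int E F.
Proof.
move=> mE mF Eoo Foo.
have sec y : mu.-integrable setT (EFin \o (fun x => \1_E x * b (x, y))).
  exact: (bounded_indicM_intg mE Eoo (meas_y y) (fun x => bc (x, y))).
have := @fubiniR2 _ _ X Y R mu nu (fun z => \1_E z.1 * \1_F z.2 * b z) (rect_intg mE mF Eoo Foo).
have -> : (fun y => \1_F y * \int[mu]_x (\1_E x * b (x, y))) =
    (fun y => \int[mu]_x (\1_E x * \1_F y * b (x, y))).
  apply/funext => y; rewrite -RintegralZl//.
  by apply: eq_Rintegral => x _; rewrite mulrCA mulrA.
apply=> y /=; have := intg_scale (\1_F y) (sec y).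
by congr integrable; apply/funext => x /=; rewrite mulrCA mulrA.
Qed.

Let indicM_idem (T : Type) (E E0 : set T) (z : T) (r : R) : E `<=` E0 ->
  \1_E z * (\1_E0 z * r) = \1_E z * r.
Proof.
by move=> h; rewrite mulrA -[\1_E z * \1_E0 z]/((\1_E \* \1_E0) z) -indicI (setIidl h).
Qed.

Hypothesis avg : forall (E : nat -> set X) (F : nat -> set Y),
  (forall n, [/\ measurable (E n), (0 < mu (E n))%E & (mu (E n) < +oo)%E]) ->
  (forall n, [/\ measurable (F n), (0 < nu (F n))%E & (nu (F n) < +oo)%E]) ->
  (forall i j, i != j -> E i `&` E j = set0 \/ F i `&` F j = set0) ->
  forall e, 0 < e -> exists n,
    `|rect_int (E n) (F n)| <= e * (fine (mu (E n)) * fine (nu (F n))).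

(** Only the side with the non-atomic measure is cut into pieces, the other being kept as a constant
    sequence. Fubini turns integrals over the resulting rectangles into integrals of a function of
    one variable. *)
Lemma rect_int0 E F : nonatomic mu \/ nonatomic nu ->
  measurable E -> measurable F -> (mu E < +oo)%E -> (nu F < +oo)%E ->
  rect_int E F = 0.
Proof.
move=> na mE mF Eoo Foo.
have [E0|E0] := eqVneq (mu E) 0%E.
  apply/eqP; rewrite -normr_le0 (le_trans (rect_int_le mE mF Eoo Foo))//.
  by rewrite E0 mul0r mulr0.
have [F0|F0] := eqVneq (nu F) 0%E.
  apply/eqP; rewrite -normr_le0 (le_trans (rect_int_le mE mF Eoo Foo))//.
  by rewrite F0 !mulr0.
have {}E0 : (0 < mu E)%E by rewrite lt_def E0 measure_ge0.
have {}F0 : (0 < nu F)%E by rewrite lt_def F0 measure_ge0.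
have fE : 0 < fine (mu E) by rewrite fine_gt0// E0.
have fF : 0 < fine (nu F) by rewrite fine_gt0// F0.
case: na => na.
  have [i1 v1] := rect_int_x mE mF Eoo Foo.
  (* The one-variable criterion is applied to the section integral multiplied by the indicator of
     [E], because it is this product that Fubini shows to be measurable and integrable. The doubled
     indicator is absorbed here. *)
  have id1 D : D `<=` E -> (fun x => \1_D x * (\1_E x * \int[nu]_y (\1_F y * b (x, y)))) =
      (fun x => \1_D x * \int[nu]_y (\1_F y * b (x, y))).
    by move=> DE; apply/funext => x; rewrite indicM_idem.
  rewrite -v1 -id1//; apply: nonatomic_int_eq0 => //.
  - by apply/measurable_EFinP; exact: (measurable_int _ i1).
  - by rewrite id1.
  - move=> D mD DE D0 Dd e e0.
    have Doo n : (mu (D n) < +oo)%E.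
      by apply: le_lt_trans Eoo; apply: le_measure; rewrite ?inE.
    (* [avg] measures against the area of the rectangle, so the constant side is divided out. *)
    have e1 : 0 < e / fine (nu F) by rewrite divr_gt0.
    have [n hn] := avg (E := D) (F := fun=> F)
      (fun n => And3 (mD n) (D0 n) (Doo n)) (fun=> And3 mF F0 Foo)
      (fun i j ij => or_introl (Dd i j ij)) e1.
    exists n; rewrite id1//.
    have [_ ->] := rect_int_x (mD n) mF (Doo n) Foo.
    apply: le_trans hn _; rewrite [fine (mu _) * _]mulrC mulrA divfK//.
    by rewrite gt_eqF.
have [i1 v1] := rect_int_y mE mF Eoo Foo.
have id1 D : D `<=` F -> (fun y => \1_D y * (\1_F y * \int[mu]_x (\1_E x * b (x, y)))) =
    (fun y => \1_D y * \int[mu]_x (\1_E x * b (x, y))).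
  by move=> DF; apply/funext => y; rewrite indicM_idem.
rewrite -v1 -id1//; apply: nonatomic_int_eq0 => //.
- by apply/measurable_EFinP; exact: (measurable_int _ i1).
- by rewrite id1.
- move=> D mD DF D0 Dd e e0.
  have Doo n : (nu (D n) < +oo)%E.
    by apply: le_lt_trans Foo; apply: le_measure; rewrite ?inE.
  have e1 : 0 < e / fine (mu E) by rewrite divr_gt0.
  have [n hn] := avg (E := fun=> E) (F := D)
    (fun=> And3 mE E0 Eoo) (fun n => And3 (mD n) (D0 n) (Doo n))
    (fun i j ij => or_intror (Dd i j ij)) e1.
  exists n; rewrite id1//.
  have [_ ->] := rect_int_y mE (mD n) Eoo (Doo n).
  by apply: le_trans hn _; rewrite mulrA divfK// gt_eqF.
Qed.

End rectangles.

Section rectangle_uniqueness.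
Variables (R : realType) (dX dY : measure_display).
Variables (X : measurableType dX) (Y : measurableType dY).
Variables (mu : {sigma_finite_measure set X -> \bar R}).
Variables (nu : {sigma_finite_measure set Y -> \bar R}).
Variables (b : X * Y -> R) (c : R).
Hypotheses (mb : measurable_fun setT b) (bc : forall z, `|b z| <= c).
Hypothesis b0 : forall E F, measurable E -> measurable F ->
  (mu E < +oo)%E -> (nu F < +oo)%E -> rect_int mu nu b E F = 0.

(** Integrals of [g], the restriction of [b] to the rectangle, vanish over measurable rectangles.
    These are stable under intersection and generate the product sigma-algebra, so Dynkin's theorem
    extends this to all measurable sets, and [g] is zero almost everywhere. *)
Lemma ae_rect0 (E : set X) (F : set Y) : measurable E -> measurable F ->
  (mu E < +oo)%E -> (nu F < +oo)%E ->
  {ae (mu \x nu)%E, forall z, (E `*` F) z -> b z = 0}.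
Proof.
move=> mE mF Eoo Foo.
pose g (z : X * Y) : R := \1_E z.1 * \1_F z.2 * b z.
have ig : (mu \x nu)%E.-integrable setT (EFin \o g) := rect_intg mb bc mE mF Eoo Foo.
have gI S : measurable S -> (\int[(mu \x nu)%E]_(z in S) (g z)%:E =
    (\int[(mu \x nu)%E]_z (\1_S z * g z))%:E)%E.
  by move=> mS; apply: integral_indicM.
pose G := [set A `*` B | A in @measurable _ X & B in @measurable _ Y].
have key (S : set (X * Y)) : measurable S -> \int[(mu \x nu)%E]_z (\1_S z * g z) = 0.
  rewrite measurable_prod_measurableType; move: S.
  apply: (@dynkin_induction _ (X * Y)%type G) => /=.
  - by rewrite measurable_prod_measurableType.
  - move=> _ _ [A1 mA1 [A2 mA2 <-]] [B1 mB1 [B2 mB2 <-]].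
    exists (A1 `&` B1); first exact: measurableI.
    by exists (A2 `&` B2); [exact: measurableI|rewrite setXI].
  - rewrite -(b0 mE mF Eoo Foo); apply: eq_Rintegral => z _.
    by rewrite indicT /= mul1r.
  - move=> _ [A mA [B mB <-]].
    rewrite -(b0 (measurableI _ _ mA mE) (measurableI _ _ mB mF)).
    + apply: eq_Rintegral => z _; rewrite indicX !indicI /= /g; ring.
    + by apply: le_lt_trans Eoo; apply: le_measure; rewrite ?inE//; exact: measurableI.
    + by apply: le_lt_trans Foo; apply: le_measure; rewrite ?inE//; exact: measurableI.
  - move=> S mS S0.
    have : \int[(mu \x nu)%E]_z (g z - \1_S z * g z) = 0.
      rewrite RintegralB//; last exact: intg_indicM.
      rewrite S0 subr0 /g; exact: b0.
    move=> <-; apply: eq_Rintegral => z _.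
    by rewrite !indicE in_setC; case: (z \in S) => /=; ring.
  - move=> S mS tS S0.
    have mU : measurable (\bigcup_k S k) by exact: bigcupT_measurable.
    apply: EFin_inj; rewrite -gI// integral_bigcup//; last first.
      exact: integrableS ig.
    by rewrite eseries0// => k _ _; rewrite gI// S0.
have ae0 : ae_eq (mu \x nu)%E setT (EFin \o g) (cst 0%E).
  apply: integral_ae_eq => // S _ mS.
  by rewrite gI// key// integral0.
apply: filterS ae0 => z /(_ I) /= [] + [Ez Fz].
by rewrite /g !indicE !mem_set// !mul1r.
Qed.

Lemma ae_rect0_all : {ae (mu \x nu)%E, forall z, b z = 0}.
Proof.
have /sigma_finiteP[E [UE ndE hE]] := sigma_finiteT mu.
have /sigma_finiteP[F [UF ndF hF]] := sigma_finiteT nu.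
have : {ae (mu \x nu)%E, forall z, forall n, (E n `*` F n) z -> b z = 0}.
  by apply: ae_foralln => n; have [? ?] := hE n; have [? ?] := hF n; exact: ae_rect0.
apply: filterS => -[x y] h.
have : [set: X] x by []. rewrite UE => -[i _ Eix].
have : [set: Y] y by []. rewrite UF => -[j _ Fjy].
(* Both exhaustions increase, so one index serves the two coordinates. *)
apply: (h (maxn i j)); split => /=.
  by move: x Eix {h}; exact/subsetPset/ndE/leq_maxl.
by move: y Fjy {h}; exact/subsetPset/ndF/leq_maxr.
Qed.

End rectangle_uniqueness.

(** * Vanishing of compact multipliers *)

Section vanishing.
Variables (R : realType) (dX dY : measure_display).
Variables (X : measurableType dX) (Y : measurableType dY).
Variables (mu : {sigma_finite_measure set X -> \bar R}).
Variables (nu : {sigma_finite_measure set Y -> \bar R}).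
Variables (H : completeNormedModType R[i]) (dot : {dot H for (@Num.conj R[i])}).
Hypothesis hd : norm_from_dot dot.
Hypothesis sepH : separable_space H.
Variables (A : set (BH H)) (phi : X * Y -> BH H -> BH H).
Hypothesis hA : Cstar_subalgebra dot A.
Hypothesis hphi : compact_Schur_multiplier dot mu nu A phi.
Hypothesis na : nonatomic mu \/ nonatomic nu.
Local Notation N x := (complex.Re `|x|).
Local Notation rdot := (real_dot dot).

Lemma coef_ae0 (a : BH H) (h g : H) : A a -> opnorm a <= 1 -> N h <= 1 ->
  {ae (mu \x nu)%E, forall z, coef dot phi a h g z = 0}.
Proof.
move=> Aa a1 h1; have mb := coef_meas hphi h g Aa.
have [c bc] := coef_le hd hA hphi h g Aa.
apply: (ae_rect0_all mb bc) => E F mE mF Eoo Foo.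
apply: (rect_int0 mb bc) => // {mE mF Eoo Foo}E {}F hE hF EF e e0.
have hu n : unit_fun mu (fun x => (Num.sqrt (fine (mu (E n))))^-1 * \1_(E n) x).
  by have [? ? ?] := hE n; exact: unit_indic.
have hv n : unit_fun nu (fun y => (Num.sqrt (fine (nu (F n))))^-1 * \1_(F n) y).
  by have [? ? ?] := hF n; exact: unit_indic.
have disj (T : Type) (B C : set T) (z : T) : B `&` C = set0 ->
    (\1_B z : R) * \1_C z = 0.
  by move=> BC; rewrite -[_ * _]/((\1_B \* \1_C) z) -indicI BC indic0.
have [m n x y mn|n hn] := diagonal_small hd sepH hA hphi g Aa a1 h1 hu hv _ e0.
  case: (EF m n mn) => d0.
    by rewrite [X in X * _]mulrACA (disj _ _ _ x d0) mulr0 mul0r.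
  by rewrite [X in _ * X]mulrACA (disj _ _ _ y d0) !mulr0.
exists n; have [mE E0 Eoo] := hE n; have [mF F0 Foo] := hF n.
have fE : 0 < fine (mu (E n)) by rewrite fine_gt0// E0.
have fF : 0 < fine (nu (F n)) by rewrite fine_gt0// F0.
(* Squaring the normalised indicators divides by [mu (E n)] and [nu (F n)], so the small diagonal
   integral is the average of [coef] over the rectangle. *)
have -> : rect_int mu nu (coef dot phi a h g) (E n) (F n) =
  fine (mu (E n)) * fine (nu (F n)) *
  \int[(mu \x nu)%E]_z (((Num.sqrt (fine (mu (E n))))^-1 * \1_(E n) z.1) ^+ 2 *
     ((Num.sqrt (fine (nu (F n))))^-1 * \1_(F n) z.2) ^+ 2 * coef dot phi a h g z).
  rewrite -RintegralZl//; last exact: (coef_integrable hd hA hphi h g Aa (hu n) (hv n)).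
  apply: eq_Rintegral => z _; rewrite !exprMn !exprVn !sqr_sqrtr ?ltW//.
  have sq (T : Type) (B : set T) (t : T) : (\1_B t : R) ^+ 2 = \1_B t.
    by rewrite indicE; case: (_ \in _); rewrite ?expr1n ?expr0n.
  by rewrite !sq; field; rewrite !gt_eqF.
have p0 : 0 <= fine (mu (E n)) * fine (nu (F n)) by rewrite ltW// mulr_gt0.
by rewrite normrM (ger0_norm p0) mulrC ler_wpM2r.
Qed.

Let sA : A `<=` dom (BH H). Proof. by case: hA. Qed.

Lemma phi_eq0 (a : BH H) (h g : H) : A a ->
  {ae (mu \x nu)%E, forall z, rdot (phi z a h) g = 0}.
Proof.
(* These factors bring [a] and [h] into the unit balls, the added [1] covering zero vectors. No
   rescaling of [g] is made: the tolerance in [diagonal_small] absorbs its norm. *)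
move=> Aa; pose r := (1 + opnorm a)^-1; pose s := (1 + N h)^-1.
have oa := opnorm_ge0 (sA Aa).
have r0 : 0 < r by rewrite invr_gt0 ltr_pwDl.
have s0 : 0 < s by rewrite invr_gt0 ltr_pwDl ?Re_norm_ge0.
have Ar : A (r%:C%C *: a) by have [_ [_ _ hZ] _ _ _] := hA; exact: hZ.
have := @coef_ae0 (r%:C%C *: a) (s%:C%C *: h) g Ar.
have h1 : opnorm (r%:C%C *: a : BH H) <= 1.
  rewrite opnormZ ?(gtr0_norm r0)//; last exact: sA.
  by rewrite /r mulrC ler_pdivrMr ?ltr_pwDl// mul1r lerDr.
have h2 : N (s%:C%C *: h) <= 1.
  rewrite Re_normZ Re_normC_real (gtr0_norm s0) /s mulrC.
  by rewrite ler_pdivrMr ?ltr_pwDl ?Re_norm_ge0// mul1r lerDr.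
move=> /(_ h1 h2); apply: filterS => z; rewrite /coef (phiZ hA hphi)//.
rewrite [X in rdot X _](_ : _ = r%:C%C *: (phi z a (s%:C%C *: h) : H))//.
rewrite BH_Z; last exact: (phi_dom hA hphi).
rewrite !rdotZl => /eqP; rewrite !mulf_eq0 (gt_eqF r0) (gt_eqF s0) /=.
by move=> /eqP.
Qed.

(** Countably many null sets are discarded, one for each triple from the dense sequences. Outside
    them density is used three times: for the test vector, for the argument in [H] and for the
    element of [A]. *)
Lemma phi_ae0 : norm_separable A ->
  {ae (mu \x nu)%E, forall z, forall a, A a -> phi z a = 0}.
Proof.
move=> [DA [cDA DAA ADA]]; have [DH cDH dDH] := sepH.
have [a_ aP] := @countable_surj (BH H) 0 DA cDA.
have [h_ hP] := @countable_surj H 0 DH cDH.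
have : {ae (mu \x nu)%E, forall z, forall i j k, A (a_ i) ->
    rdot (phi z (a_ i) (h_ j)) (h_ k) = 0}.
  apply: ae_foralln => i; apply: ae_foralln => j; apply: ae_foralln => k.
  have [Ai|nAi] := pselect (A (a_ i)); last exact: aeW.
  by apply: filterS (phi_eq0 (h_ j) (h_ k) Ai).
apply: filterS => z hz.
have dense_h (x : H) r : 0 < r -> exists k, N (x - h_ k) < r.
  move=> r0; have [y Dy xy] := @dense_approx R H DH dDH x r r0.
  by have [k kE] := hP y Dy; exists k; rewrite kE.
have small0 (t : R) C : 0 <= t -> (forall r, 0 < r -> t <= C * r) -> t = 0.
  move=> t0 ht; apply/eqP; rewrite eq_le t0 andbT leNgt; apply/negP => tp.
  have C1 : 0 < `|C| + 1 by rewrite ltr_wpDl.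
  have := ht (t / (2 * (`|C| + 1))) ltac:(by rewrite divr_gt0// mulr_gt0).
  apply/negP; rewrite -ltNge mulrA ltr_pdivrMr ?mulr_gt0// mulrC ltr_pM2l//.
  have := ler_norm C; have := normr_ge0 C; lra.
(* For [w] the vector at hand, [|w|^2 = <w, w - h_k>], and [h_k] can be taken arbitrarily close to
   [w]. *)
have z1 i j : A (a_ i) -> phi z (a_ i) (h_ j) = 0.
  move=> Ai; set w : H := phi z (a_ i) (h_ j); apply: Re_norm_eq0.
  apply: (small0 _ 1); first exact: Re_norm_ge0.
  move=> r r0; rewrite mul1r; have [->|w0] := eqVneq (N w) 0; first exact: ltW.
  have wp : 0 < N w by rewrite lt_def w0 Re_norm_ge0.
  have [k kw] := dense_h w r r0.
  rewrite -(ler_pM2l wp) -expr2 -(rdot_norm hd) -[leLHS]subr0 -(hz i j k Ai) -rdotBr.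
  rewrite (le_trans (ler_norm _))// (le_trans (real_dot_CauchySchwarz hd _ _))// ler_wpM2l ?Re_norm_ge0//.
  exact: ltW.
have z2 i : A (a_ i) -> phi z (a_ i) = 0.
  move=> Ai; have dp := phi_dom hA hphi z Ai; apply/funext => x; apply: Re_norm_eq0.
  apply: (small0 _ (opnorm (phi z (a_ i)))); first exact: Re_norm_ge0.
  move=> r r0; have [j xj] := dense_h x r r0.
  rewrite -[x](subrK (h_ j)) BH_D// z1// addr0 (le_trans (BH_le _ dp))//.
  by rewrite ler_wpM2l ?opnorm_ge0// ltW.
move=> a Aa; have dp := phi_dom hA hphi z Aa; apply: BH_eq0 => //.
(* As [phi z] vanishes at [s], its value at [a] is its value at [a - s], which the bound on [phi z]
   makes arbitrarily small. *)
have [c hc] := phi_le hphi.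
apply: (small0 _ `|c|); first exact: opnorm_ge0.
move=> r r0; have [_ /(_ r r0) [s Ds sr]] := ADA a Aa.
have [i iE] := aP s Ds; have As := DAA s Ds.
have As' : A (a - s).
  have [_ [_ hD hZ] _ _ _] := hA; apply: hD => //.
  by rewrite -scaleN1r; exact: hZ.
have := phi_lin hA hphi z 1 As' As; rewrite !scale1r subrK => ->.
have := z2 i; rewrite iE => -> //; rewrite addr0.
apply: le_trans (hc z _ As') _; apply: le_trans (ler_norm _) _.
rewrite normrM ler_wpM2l// ger0_norm; first exact: ltW.
by apply: opnorm_ge0; exact: sA.
Qed.

End vanishing.

Theorem proposition3p4 (R : realType) (dX dY : measure_display)
  (X : measurableType dX) (Y : measurableType dY)
  (mu : {sigma_finite_measure set X -> \bar R})
  (nu : {sigma_finite_measure set Y -> \bar R})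
  (H : completeNormedModType R[i]) (dot : {dot H for (@Num.conj R[i])})
  (A : set (BH H)) (phi : X * Y -> BH H -> BH H) :
  standard_measure mu -> standard_measure nu ->
  nonatomic mu \/ nonatomic nu ->
  norm_from_dot dot -> separable_space H ->
  Cstar_subalgebra dot A -> norm_separable A ->
  compact_Schur_multiplier dot mu nu A phi ->
  {ae (mu \x nu)%E, forall z, forall a, A a -> phi z a = 0}.
Proof.
move=> _ _ na hd sepH hA sepA hphi.
exact: (phi_ae0 hd sepH hA hphi na sepA).
Qed.
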